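(* For each integer $n>1$, let $D_n$ be the twisted knot represented by the oriented twisted knot diagram with $2n$ classical crossings $a_1,\dots,a_{2n}$, all positive, and three bars, which when traversed once along its orientation yields the cyclic sequence (virtual crossings omitted) $$O a_1\;\;|\;\;U a_2\;\;U a_3\;\cdots\;U a_{2n-1}\;\;|\;\;U a_{2n}\;\;U a_1\;\;|\;\;O a_2\;\;O a_3\;\cdots\;O a_{2n},$$ where $O$ and $U$ denote over- and under-passages and $|$ denotes a bar. Then the arc shift number of $D_n$ satisfies $$A(D_n)=n .$$
   Context: Twisted diagrams. A twisted link diagram is a generic immersion of circles in the plane in which every double point is either a classical crossing (with over/under information) or a virtual crossing, together with finitely many bars (short transverse marks) placed on edges away from the crossings. A twisted knot diagram has one circle. Two diagrams are equivalent if they are related by planar isotopy and a finite sequence of: the classical Reidemeister moves RI, RII, RIII; the virtual Reidemeister moves VR1, VR2, VR3 (the analogous moves with all crossings virtual); the semi-virtual move SV (a strand having two virtual crossings is moved across a classical crossing); and the twisted moves TI (a bar slides along its strand through a virtual crossing), TII (two bars adjacent on the same edge are cancelled or created), TIII (a classical crossing with a bar on each of its four legs is replaced by the configuration in which the two strands cross virtually, then classically, then virtually, with no bars, joining the same pairs of endpoints, where the formerly over strand is now the under strand at the classical crossing and the sign of the crossing is unchanged). A twisted knot is an equivalence class of twisted knot diagrams. All diagrams with the same cyclic sequence of passages and bars and the same crossing signs are equivalent, so the data in the claim determine $D_n$. Sign. A classical crossing is positive if the under-strand direction is obtained from the over-strand direction by a counterclockwise rotation by an angle less than $\pi$, and negative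 otherwise. An explicit planar picture of $D_n$: a horizontal strand, oriented to the right, is met at $x=1,2,\dots,4n-2$ by vertical strands oriented alternately up, down, up, ..., down, consecutive ones being joined alternately at the top ($1$ to $2$), at the bottom ($2$ to $3$), and so on; the right end of the horizontal strand is joined to the bottom of strand $1$ and the bottom of strand $4n-2$ is joined to the left end of the horizontal strand, these two connecting curves crossing once virtually. At $x=1$ the horizontal strand is over (crossing $a_1$); at $x=2,4,\dots,4n-2$ the vertical strand is over (crossings $a_2,\dots,a_{2n}$); at $x=3,5,\dots,4n-3$ the crossings are virtual. There are bars on the horizontal strand between $x=1$ and $x=2$, on the horizontal strand between $x=4n-3$ and $x=4n-2$, and on the top connection between vertical strands $1$ and $2$. Arc shift. In a twisted knot diagram, an arc segment $(a,b)$ is a segment of the diagram with endpoints $a,b$ (non-crossing points) that passes through exactly one pair of crossings $(c_1,c_2)$ (classical or virtual), with $a$ adjacent to $c_1$ and $b$ adjacent to $c_2$; it may carry bars. An arc shift move on $(a,b)$ cuts the diagram at $a$ and $b$ and reconnects the ends after interchanging them, so that the segment is traversed in the opposite direction (its orientation is reversed) while over/under information at its crossings is kept; all new intersections created are virtual crossings. A trivial twisted knot is either the trivial knot (a crossingless closed curve) or the trivial knot with one bar. For a diagram $D$, $A(D)$ is the minimum number of arc shift moves required to transform $D$ into a trivial twisted knot (equivalence moves may be used freely in addition). For a twisted knot $K$, $A(K)=\min\{A(D) : D \text{ represents } K\}$. *)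

(* Defs.v *)
From Stdlib Require Import Relations.Relation_Operators.
From HB Require Import structures.
From mathcomp Require Import all_boot.

Set Implicit Arguments.
Unset Strict Implicit.
Unset Printing Implicit Defensive.

(* An oriented knot diagram is encoded by the cyclic word met when it is
   traversed once: every passage through a double point, virtual ones included,
   and every bar.  With the side from which the other strand comes recorded at
   each passage, the word is a combinatorial map, so it determines the immersed
   curve up to isotopy of the sphere as soon as the surface it describes is the
   sphere (see [planar]).  Plane diagrams differing only in the choice of the
   outer face are identified; they are equivalent twisted diagrams, having the
   same passages, bars and signs. *)

Inductive level := Over | Under | Virtual.

Definition level_code l :=
  match l with Over => Some true | Under => Some false | Virtual => None end.
Definition level_decode o :=
  match o with Some true => Over | Some false => Under | None => Virtual end.
Lemma level_codeK : cancel level_code level_decode. Proof. by case. Qed.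
HB.instance Definition _ := Equality.copy level (can_type level_codeK).

(* [dir] is true when the other strand crosses from right to left, as seen by
   the traveller who makes the passage. *)
Record passage := Passage { label : nat; lev : level; dir : bool }.

Definition passage_code p := (label p, lev p, dir p).
Definition passage_decode t := let: (c, l, d) := t in Passage c l d.
Lemma passage_codeK : cancel passage_code passage_decode. Proof. by case. Qed.
HB.instance Definition _ := Equality.copy passage (can_type passage_codeK).

(* [None] is a bar. *)
Definition item := option passage.
Definition bar : item := None.
Definition pass (c : nat) (l : level) (d : bool) : item := Some (Passage c l d).
Definition word := seq item.

Definition passages (w : word) : seq passage := pmap id w.
Definition labels (w : word) : seq nat := map label (passages w).

Definition classical (p : passage) : bool := lev p != Virtual.

Definition opposite_level l :=
  match l with Over => Under | Under => Over | Virtual => Virtual end.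

(* The two strands of a double point see each other cross in opposite
   directions. *)
Definition well_formed (w : word) : bool :=
  all (fun p => (count_mem (label p) (labels w) == 2) &&
         (Passage (label p) (opposite_level (lev p)) (~~ dir p) \in passages w))
      (passages w).

(* The under direction is obtained from the over direction by a
   counterclockwise rotation exactly when the under strand crosses the over
   strand from right to left. *)
Definition positive (w : word) (c : nat) : bool :=
  Passage c Over true \in passages w.

Section Faces.
Variable ps : seq passage.
Local Notation place := 'I_(size ps).

Definition other_place (i : place) : place :=
  odflt i [pick j : place | (j != i) &&
     (label (tnth (in_tuple ps) j) == label (tnth (in_tuple ps) i))].

(* The edge [i] goes from the passage [i] to the passage [ordS i].  A directed
   edge [(i, true)] follows the orientation, [(i, false)] goes against it.
   [face_next] turns left at the end of the directed edge, hence follows the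
   boundary of the face lying on the left. *)
Definition face_next (e : place * bool) : place * bool :=
  let i := if e.2 then ordS e.1 else e.1 in
  let j := other_place i in
  if dir (tnth (in_tuple ps) i) == e.2 then (j, true) else (ord_pred j, false).

End Faces.

(* Euler's formula V - E + F = 2 with E = 2V; a curve without double points
   is always planar. *)
Definition planar (w : word) : bool :=
  let ps := passages w in
  (ps == [::]) || (fcard (@face_next ps) predT == (size ps)./2 + 2).

Definition diagram (w : word) : bool := well_formed w && planar w.

(* Planar isotopy: change of base point and of the names of double points. *)
Definition relabel (f : nat -> nat) (p : passage) : passage :=
  Passage (f (label p)) (lev p) (dir p).

Definition isotopic (w w' : word) : Prop :=
  exists (i : nat) (f : nat -> nat),
    {in labels w &, injective f} /\ w' = map (omap (relabel f)) (rot i w).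

(* A segment is an edge without bars, given by the passages at its start and
   at its end. *)
Definition segment := (passage * passage)%type.
Definition seg (P : segment) : word := [:: Some P.1; Some P.2].
Definition swap (P : segment) : segment := (P.2, P.1).

Definition both (l : level) (P : segment) : bool :=
  (lev P.1 == l) && (lev P.2 == l).

(* Turning left at the end of [P] traversed in the direction [a] (true: along
   the orientation) leads to [Q] traversed in the direction [b]; compare
   [face_next]. *)
Definition turns (P : segment) (a : bool) (Q : segment) (b : bool) : bool :=
  let e := if a then P.2 else P.1 in
  let s := if b then Q.1 else Q.2 in
  (label e == label s) && (b == (dir e == a)).

Definition bigon (P Q : segment) : Prop :=
  exists a b : bool, turns P a Q b /\ turns Q b P a.

Definition left_triangle (P Q R : segment) : Prop :=
  exists a b c : bool, [/\ turns P a Q b, turns Q b R c & turns R c P a].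

Definition triangle (P Q R : segment) : Prop :=
  left_triangle P Q R \/ left_triangle P R Q.

(* The base point may be chosen freely (see [isotopic]), so each move starts at
   a convenient place.  Adjacent passages of the same double point always bound
   a monogon, so RI and VR1 need no condition on faces. *)
Inductive move : word -> word -> Prop :=
| RI p q u : label p = label q -> classical p ->
    move (seg (p, q) ++ u) u
| RII P Q u v : bigon P Q -> both Over P -> both Under Q ->
    move (seg P ++ u ++ seg Q ++ v) (u ++ v)
| RIII P Q R u v t : triangle P Q R ->
    both Over P -> both Under Q || both Under R ->
    move (seg P ++ u ++ seg Q ++ v ++ seg R ++ t)
         (seg (swap P) ++ u ++ seg (swap Q) ++ v ++ seg (swap R) ++ t)
| VR1 p q u : label p = label q -> ~~ classical p ->
    move (seg (p, q) ++ u) u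
| VR2 P Q u v : bigon P Q -> both Virtual P -> both Virtual Q ->
    move (seg P ++ u ++ seg Q ++ v) (u ++ v)
| VR3 P Q R u v t : triangle P Q R ->
    both Virtual P -> both Virtual Q -> both Virtual R ->
    move (seg P ++ u ++ seg Q ++ v ++ seg R ++ t)
         (seg (swap P) ++ u ++ seg (swap Q) ++ v ++ seg (swap R) ++ t)
| SV P Q R u v t : triangle P Q R ->
    both Virtual P -> classical Q.1 || classical Q.2 ->
    move (seg P ++ u ++ seg Q ++ v ++ seg R ++ t)
         (seg (swap P) ++ u ++ seg (swap Q) ++ v ++ seg (swap R) ++ t)
| TI c d u :
    move ([:: bar; pass c Virtual d] ++ u) ([:: pass c Virtual d; bar] ++ u)
| TII u :
    move ([:: bar; bar] ++ u) u
(* The three crossings of the right-hand side may be met in the same order or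
   in opposite orders by the two strands, according to whether they are stacked
   along or across the common direction of the strands.  Each crossing flips
   the sides of the strands, so the middle one has the opposite [dir] and,
   over and under being exchanged, the same sign. *)
| TIII_parallel c d x y u v :
    move ([:: bar; pass c Over d; bar] ++ u ++
          [:: bar; pass c Under (~~ d); bar] ++ v)
         ([:: pass x Virtual d; pass c Under (~~ d); pass y Virtual d] ++ u ++
          [:: pass x Virtual (~~ d); pass c Over d; pass y Virtual (~~ d)] ++ v)
| TIII_antiparallel c d x y u v :
    move ([:: bar; pass c Over d; bar] ++ u ++
          [:: bar; pass c Under (~~ d); bar] ++ v)
         ([:: pass x Virtual d; pass c Under (~~ d); pass y Virtual d] ++ u ++
          [:: pass y Virtual (~~ d); pass c Over d; pass x Virtual (~~ d)] ++ v).

(* Requiring both sides to be planar makes the moves local: a bigon created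
   in a planar diagram necessarily joins two edges of a common face. *)
Definition elementary (w w' : word) : Prop :=
  [/\ diagram w, diagram w' & isotopic w w' \/ move w w'].

Definition equivalent : word -> word -> Prop :=
  clos_refl_sym_trans word elementary.

Definition twisted_knot (w : word) : word -> Prop :=
  fun w' => diagram w' /\ equivalent w w'.

(* Reversing one strand of a double point changes [dir] at both passages. *)
Definition flip (C : seq nat) (p : passage) : passage :=
  if label p \in C then Passage (label p) (lev p) (~~ dir p) else p.

(* [erase N w] forgets the double points of [w] whose label is in [N]. *)
Definition keep (N : seq nat) (x : item) : bool :=
  if x is Some p then label p \notin N else true.
Definition erase (N : seq nat) (w : word) : word := filter (keep N) w.

(* [s] is the arc segment from a to b; it passes through two crossings.  After
   the move, [x1] joins the incoming end at a to the b-end of the segment, and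
   [x2] joins the a-end of the segment to the outgoing end at b.  The new double
   points, with labels [N], are virtual and lie on [x1] or [x2]. *)
Definition arc_shift (w w' : word) : Prop :=
  exists (s t x1 s' x2 t' : word) (c1 c2 : nat),
    let N := labels (x1 ++ x2) in
    [/\ [/\ diagram w, w = s ++ t, labels s = [:: c1; c2] & c1 != c2],
        [/\ diagram w' & w' = x1 ++ s' ++ x2 ++ t'],
        [/\ ~~ has (mem (labels w)) N, bar \notin x1 ++ x2 &
            all (fun p => (label p \in N) ==> ~~ classical p) (passages w')],
        erase N s' = rev (map (omap (flip [:: c1; c2])) s) &
        erase N t' = map (omap (flip [:: c1; c2])) t].

Inductive transforms : nat -> word -> word -> Prop :=
| transforms0 w w' : equivalent w w' -> transforms 0 w w'
| transformsS k w w1 w2 w' :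
    equivalent w w1 -> arc_shift w1 w2 -> transforms k w2 w' ->
    transforms k.+1 w w'.

Definition trivial_diagram (w : word) : Prop := w = [::] \/ w = [:: bar].

Definition least (P : nat -> Prop) (k : nat) : Prop :=
  P k /\ forall j, P j -> k <= j.

Definition diagram_arc_shift_number (w : word) : nat -> Prop :=
  least (fun k => exists2 u, trivial_diagram u & transforms k w u).

Definition arc_shift_number (K : word -> Prop) : nat -> Prop :=
  least (fun k => exists2 w, K w & diagram_arc_shift_number w k).

(* Names of the double points of the picture of D_n: [la k] for a_k, [lv j] for
   the virtual crossing at x = 2j + 1, where 1 <= j <= 2n - 2, and [lv 0] for the
   crossing of the two connecting curves. *)
Definition la (k : nat) : nat := k.*2.
Definition lv (j : nat) : nat := j.*2.+1.

(* The horizontal strand goes to the right; vertical strands going up cross it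
   from right to left, those going down from left to right. *)
Definition D_horizontal (n : nat) : word :=
  [:: pass (la 1) Over true; bar] ++
  flatten [seq [:: pass (la j.+1) Under false; pass (lv j) Virtual true]
          | j <- iota 1 (n.*2 - 2)] ++
  [:: bar; pass (la n.*2) Under false].

(* The vertical strands 1, 2, ..., 4n - 2, travelled up, down, up, ... *)
Definition D_vertical (n : nat) : word :=
  [:: pass (la 1) Under false; bar] ++
  flatten [seq [:: pass (la j.+1) Over true; pass (lv j) Virtual false]
          | j <- iota 1 (n.*2 - 2)] ++
  [:: pass (la n.*2) Over true].

Definition D (n : nat) : word :=
  D_horizontal n ++ [:: pass (lv 0) Virtual true] ++
  D_vertical n ++ [:: pass (lv 0) Virtual false].

Definition not_virtual (x : item) : bool := if x is Some p then classical p else true.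

Lemma D_gauss (n : nat) : 0 < n ->
  [seq x <- D n | not_virtual x] =
    [:: pass (la 1) Over true; bar] ++
    [seq pass (la k) Under false | k <- iota 2 (n.*2 - 2)] ++
    [:: bar; pass (la n.*2) Under false; pass (la 1) Under false; bar] ++
    [seq pass (la k) Over true | k <- iota 2 (n.*2).-1].
Proof.
move=> n0.
have H l d e m i : l != Virtual ->
    [seq x <- flatten [seq [:: pass (la j.+1) l d; pass (lv j) Virtual e]
       | j <- iota i m] | not_virtual x] =
    [seq pass (la k) l d | k <- iota i.+1 m].
  by move=> Hl; elim: m i => //= m IH i; rewrite /classical /= Hl IH.
rewrite /D /D_horizontal /D_vertical !filter_cat !H //= -!catA /=.
rewrite (_ : (n.*2).-1 = (n.*2 - 2) + 1); last by case: n n0 => // n _; rewrite doubleS subn2 addn1.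
rewrite iotaD map_cat /= (_ : 2 + (n.*2 - 2) = n.*2) ?catA // -?catA /=.
by rewrite subnKC // -[2]/(1.*2) leq_double.
Qed.

Lemma D_positive (n k : nat) : 0 < n -> 0 < k <= n.*2 -> positive (D n) (la k).
Proof.
move=> n0 /andP[k0 kn]; rewrite /positive /passages mem_pmap map_id.
suff: pass (la k) Over true \in [seq x <- D n | not_virtual x].
  by rewrite mem_filter => /andP[].
rewrite D_gauss //; case: k k0 kn => // -[|k] _ kn; first exact: mem_head.
rewrite !mem_cat; apply/orP; right; apply/orP; right; apply/orP; right.
apply/mapP; exists k.+2 => //; rewrite mem_iota /=.
by rewrite add2n ltnS; case: (n.*2) kn.
Qed.

(* Main.v *)
(* The odd writhe J, the sum of the signs of the crossings whose two passages are
   separated by an odd number of classical passages, is invariant under all the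
   equivalence moves, TIII included: it exchanges over and under but keeps the
   sign and the cyclic place of a crossing.  An arc shift exchanges two adjacent
   passages and flips the signs of their crossings, so it changes J by at most
   2.  All 2n crossings of D_n are odd and positive, hence n arc shifts are needed.

   Conversely, an arc shift of the segment from a_2 to the next virtual crossing
   flips the sign of a_2.  With the virtual crossings on the reconnecting curve
   chosen well, VR2, RII and VR2 then remove a_2, a_3 and all the virtual
   crossings next to them, which leaves D_{n-1}; D_1 is unknotted in the same way.

   That all these diagrams are planar for every n follows from a replacement
   principle: the faces are the orbits of a permutation of the darts, and
   exchanging a two-strand tangle for another one through which the faces pass
   in the same way changes the number of faces only by the faces inside it. *)
Require Import Defs.
From Stdlib Require Import Relations.Relation_Operators.
From mathcomp Require Import all_boot order ssralg ssrnum ssrint zify.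

Set Implicit Arguments.
Unset Strict Implicit.
Unset Printing Implicit Defensive.

(** * Orbits and first returns *)

(** [face_next] acts on ['I_(size ps) * bool], a type that changes with the word, so the faces of
    two diagrams cannot be compared directly. They are transported to pairs of a passage and a
    direction by an injective map that intertwines [face_next] with a self-map of such pairs. Two
    words that differ by a tangle then share the darts outside it, and only the first-return map to
    these has to agree. For the tangles needed here, which have at most seven double points, this is
    a finite computation.

    For the odd writhe, each classical passage receives a Boolean colour, alternating along the
    word, and then the order is forgotten: the writhe is a sum over a coloured multiset. Passages
    that form whole crossings can be split off from it, so that a move or an arc shift is judged by
    the colours and signs of the few passages that it touches. *)

Lemma fcycle_closed (X : eqType) (F : X -> X) c x :
  fcycle F c -> x \in c -> F x \in c.
Proof. by move=> Fc cx; rewrite (eqP (next_cycle Fc cx)) mem_next. Qed.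

Lemma fcycle_iter (X : eqType) (F : X -> X) c x n :
  fcycle F c -> x \in c -> iter n F x \in c.
Proof. by move=> Fc cx; elim: n => //= n; apply: fcycle_closed. Qed.

Lemma fcycle_reach (X : eqType) (F : X -> X) c x y :
  fcycle F (x :: c) -> y \in x :: c -> exists n, iter n F x = y.
Proof.
move=> /= /fpathP[n] rc; rewrite in_cons => /predU1P[->|cy].
  by exists 0.
have: y \in rcons c x by rewrite mem_rcons in_cons cy orbT.
by rewrite rc => /trajectP[i _ ->]; exists i.+1; rewrite iterSr.
Qed.

Section Orbits.
Variables (T : finType) (f : T -> T) (X : eqType) (r : T -> X) (F : X -> X).
Hypotheses (injf : injective f) (injr : injective r).
Hypothesis rf : forall t, r (f t) = F (r t).

Lemma iter_semiconj n t : r (iter n f t) = iter n F (r t).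
Proof. by elim: n => //= n <-. Qed.

Lemma fconnectP_semiconj s t :
  reflect (exists n, iter n F (r s) = r t) (fconnect f s t).
Proof.
apply: (iffP idP) => [st|[n]].
  by exists (findex f s t); rewrite -iter_semiconj iter_findex.
by rewrite -iter_semiconj => /injr <-; apply: fconnect_iter.
Qed.

(** Peeling off one listed cycle removes exactly one orbit, since a closed cycle of [F] is a whole
    orbit. The inclusion in the image of [r] ensures that each listed cycle comes from an orbit of
    [f]. *)
Lemma fcard_cycles (cs : seq (seq X)) :
  all (fun c => (c != [::]) && fcycle F c) cs -> uniq (flatten cs) ->
  {subset flatten cs <= codom r} ->
  fcard f [pred t | r t \in flatten cs] = size cs.
Proof.
elim: cs => [|c cs IH] /=.
  by move=> _ _ _; apply: eq_card0 => t; rewrite !inE andbF.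
move=> /andP[/andP[c0 Fc] Fcs]; rewrite cat_uniq => /and3P[_ ccs ucs] sub.
rewrite /n_comp_mem -(cardID [pred t | r t \in c]) -add1n; congr (_ + _).
  case: c c0 Fc {ccs} sub => // x c _ Fc sub.
  have /codomP[t def_x] : x \in codom r by apply: sub; rewrite mem_head.
  rewrite -[RHS](n_comp_connect (fconnect_sym injf) t); apply: eq_card => s.
  rewrite !inE -andbA; congr (_ && _).
  rewrite -[r s \in _]/(r s \in c ++ flatten cs) mem_cat -in_cons.
  apply/idP/idP => [/andP[_ /(fcycle_reach Fc) h]|].
    by apply/fconnectP_semiconj; rewrite -def_x.
  case/fconnectP_semiconj => n; rewrite -def_x => <-.
  have sc := fcycle_iter n Fc (mem_head x c).
  by move: (sc); rewrite in_cons orbA => ->.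
rewrite -{}IH //; last by move=> y ycs; apply: sub; rewrite mem_cat ycs orbT.
apply: eq_card => t; rewrite !inE mem_cat; case: (boolP (r t \in c)) => // ct /=.
have /negPf-> : r t \notin flatten cs by apply: contra ccs => ?; apply/hasP; exists (r t).
by rewrite andbF.
Qed.

End Orbits.

(** * First-return maps and the orbits that meet a given set *)

Definition first_return (X : eqType) (F : X -> X) (E : pred X) (x y : X) :=
  E y /\ exists2 s, fpath F x (rcons s y) & all (predC E) s.

Section FirstReturn.
Variables (X : eqType) (F : X -> X) (E : pred X).

(** Nothing strictly between [x] and [y] lies in [E], so a later iterate in [E] is [y] or comes
    after it. The bound on [m] is the decrease used by the induction in [same_return_reach]. *)
Lemma first_return_iter x y n :
  first_return F E x y -> E (iter n.+1 F x) ->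
  exists2 m, m <= n & iter m F y = iter n.+1 F x.
Proof.
case=> Ey [s /fpathP[k def_s] Es] En.
have szk: k = (size s).+1 by rewrite -(size_traject F (F x) k) -def_s size_rcons.
move: def_s; rewrite szk trajectSr => /rcons_inj[def_s def_y].
have le_n: size s <= n.
  rewrite leqNgt; apply/negP => lt_n; have /(allP Es) : iter n.+1 F x \in s.
    by rewrite def_s; apply/trajectP; exists n; rewrite // iterSr.
  by rewrite /= En.
exists (n - size s); first exact: leq_subr.
by rewrite def_y -iterSr -iterD addnS subnK.
Qed.

Lemma first_return_reach x y : first_return F E x y -> exists n, iter n F x = y.
Proof.
case=> _ [s /fpathP[k def_s] _]; exists k.
have := congr1 (last x) def_s; rewrite last_rcons => ->.
by rewrite last_traject.
Qed.

End FirstReturn.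

(** A path from [E] to [E] is cut at its visits to [E]; each piece is a first return, common to both
    maps. *)
Lemma same_return_reach (X : eqType) (F1 F2 : X -> X) (E : pred X) :
  (forall x, E x -> exists2 y, first_return F1 E x y & first_return F2 E x y) ->
  forall x n, E x -> E (iter n F1 x) -> exists m, iter m F2 x = iter n F1 x.
Proof.
move=> ret x n; have [N] := ubnP n; elim: N n x => // N IH [|n] x ltN Ex En.
  by exists 0.
have [y r1 r2] := ret x Ex; have [m le_mn eqm] := first_return_iter r1 En.
have [k Fk] := first_return_reach r2.
have [||j Fj] := IH m y (leq_ltn_trans le_mn ltN); rewrite ?eqm //; first by case: r1.
by exists (j + k); rewrite iterD Fk Fj.
Qed.

Section Compare.
Variables (T1 T2 : finType) (f1 : T1 -> T1) (f2 : T2 -> T2) (X : eqType).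
Variables (r1 : T1 -> X) (r2 : T2 -> X) (F1 F2 : X -> X) (E : seq X).
Hypotheses (injf1 : injective f1) (injr1 : injective r1).
Hypotheses (injf2 : injective f2) (injr2 : injective r2).
Hypothesis rf1 : forall t, r1 (f1 t) = F1 (r1 t).
Hypothesis rf2 : forall t, r2 (f2 t) = F2 (r2 t).
Hypotheses (sub1 : {subset E <= codom r1}) (sub2 : {subset E <= codom r2}).

Definition meets (T : finType) (f : T -> T) (r : T -> X) :=
  [pred t | [exists s, fconnect f t s && (r s \in E)]].

(** The point is the index type ['I_(size E)] on the right, which involves neither [T] nor [f]:
    orbit counts of maps on different finite types become comparable there. *)
Lemma fcard_meets (T : finType) (f : T -> T) (r : T -> X) (h : 'I_(size E) -> T) :
  injective f -> injective r -> (forall i, r (h i) = tnth (in_tuple E) i) ->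
  fcard f (meets f r) = n_comp [rel i j | fconnect f (h i) (h j)] predT.
Proof.
move=> injf injr hE; have symf := fconnect_sym injf.
set e' := [rel i j | _].
(* Pulled back from [fconnect], [e'] is already reflexive and transitive. *)
have e'E : connect e' =2 e'.
  move=> i j; apply/idP/idP => [/connectP[p]|]; last exact: connect1.
  elim: p i => [|k p IH] i /=; first by move=> _ ->; apply: connect0.
  by move=> /andP[ik pk] /(IH _ pk); apply: connect_trans.
have cl : fclosed f (meets f r).
  move=> x y fxy; rewrite !inE; apply: eq_existsb => s.
  by rewrite (same_connect1 symf fxy).
have mh i : h i \in meets f r.
  by apply/existsP; exists (h i); rewrite connect0 hE mem_tnth.
rewrite (@adjunction_n_comp _ _ h _ e' symf _ _ cl); last 1 first.
- split=> [t|i j _]; last by rewrite e'E.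
  move=> mt; have [s /andP[ts sE]] := sigW (existsP mt).
  exists (Ordinal (etrans (index_mem _ _) sE)).
  rewrite (_ : h _ = s) //; apply: injr; rewrite hE (tnth_nth (r s)) /=.
  exact: nth_index.
- by apply: eq_n_comp_r => i; rewrite !inE; apply: (mh i).
by move=> i j; rewrite !e'E; apply: symf.
Qed.

Hypothesis ret : forall x, x \in E ->
  exists2 y, first_return F1 (mem E) x y & first_return F2 (mem E) x y.

Lemma fcard_same_return : fcard f1 (meets f1 r1) = fcard f2 (meets f2 r2).
Proof.
have inv (T : finType) (r : T -> X) : {subset E <= codom r} ->
    {h : 'I_(size E) -> T | forall i, r (h i) = tnth (in_tuple E) i}.
  move=> sub; exists (fun i => iinv (sub _ (mem_tnth i (in_tuple E)))) => i.
  exact: f_iinv.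
have [h1 hE1] := inv _ _ sub1; have [h2 hE2] := inv _ _ sub2.
rewrite (fcard_meets injf1 injr1 hE1) (fcard_meets injf2 injr2 hE2).
apply: eq_n_comp; apply: eq_connect => i j /=.
have ret' x : x \in E ->
    exists2 y, first_return F2 (mem E) x y & first_return F1 (mem E) x y.
  by case/ret => y; exists y.
have tE k : tnth (in_tuple E) k \in E by apply: mem_tnth.
apply/(fconnectP_semiconj injr1 rf1)/(fconnectP_semiconj injr2 rf2).
  rewrite hE1 hE2 => -[n def_j].
  have [|m Fm] := same_return_reach ret (tE i) (n := n); first by rewrite def_j hE1 /=.
  by exists m; rewrite Fm def_j hE1 hE2.
rewrite hE1 hE2 => -[n def_j].
have [|m Fm] := same_return_reach ret' (tE i) (n := n); first by rewrite def_j hE2 /=.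
by exists m; rewrite Fm def_j hE1 hE2.
Qed.

End Compare.

(** The case where [E] is the whole common image: every orbit meets it and a first return is a
    single step. It serves for changes of base point and of names. *)
Lemma fcard_same_codom (T1 T2 : finType) (f1 : T1 -> T1) (f2 : T2 -> T2)
    (X : eqType) (r1 : T1 -> X) (r2 : T2 -> X) (F : X -> X) :
  injective f1 -> injective r1 -> injective f2 -> injective r2 ->
  (forall t, r1 (f1 t) = F (r1 t)) -> (forall t, r2 (f2 t) = F (r2 t)) ->
  codom r1 =i codom r2 -> fcard f1 predT = fcard f2 predT.
Proof.
move=> injf1 injr1 injf2 injr2 rf1 rf2 eqr.
have sub2 : {subset codom r1 <= codom r2} by move=> x; rewrite eqr.
have ret x : x \in codom r1 -> exists2 y,
    first_return F (mem (codom r1)) x y & first_return F (mem (codom r1)) x y.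
  have fr t : first_return F (mem (codom r1)) (r1 t) (F (r1 t)).
    split; first by rewrite /= -rf1 codom_f.
    by exists [::]; rewrite //= eqxx.
  by case/codomP=> t ->; exists (F (r1 t)).
have := fcard_same_return injf1 injr1 injf2 injr2 rf1 rf2 (fun x h => h) sub2 ret.
have all_meet (T : finType) (f : T -> T) (r : T -> X) :
    codom r1 =i codom r -> meets (codom r1) f r =i predT.
  move=> eqc t; rewrite !inE; apply/existsP; exists t.
  by rewrite connect0 eqc codom_f.
rewrite (eq_n_comp_r (all_meet _ f1 r1 (fun x => erefl))).
by rewrite (eq_n_comp_r (all_meet _ f2 r2 eqr)).
Qed.

(** * Faces as orbits of darts *)

(* A dart [(p, b)] arrives at the passage [p], along the orientation if [b]. *)
Definition dart := (passage * bool)%type.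

Definition mate (p : passage) : passage :=
  Passage (label p) (opposite_level (lev p)) (~~ dir p).

(** [well_formed w] is convertible to this condition on [passages w], and the proofs switch between
    the two by conversion. *)
Definition matched (ps : seq passage) : bool :=
  all (fun p => (count_mem (label p) (map label ps) == 2) && (mate p \in ps)) ps.

Definition dart_next (ps : seq passage) (d : dart) : dart :=
  if dir d.1 == d.2 then (next ps (mate d.1), true)
  else (prev ps (mate d.1), false).

Lemma mateK : involutive mate.
Proof. by case=> c [] d; rewrite /mate /= negbK. Qed.

Lemma mate_neq p : mate p != p.
Proof. by apply: contraTneq isT => /(congr1 dir) /=; case: (dir p). Qed.

Lemma next_nth_mod (T : eqType) (x0 : T) s i : uniq s -> i < size s ->
  next s (nth x0 s i) = nth x0 s (i.+1 %% size s).
Proof.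
case: s => // y s us lt_i; rewrite next_nth mem_nth // index_uniq //.
move: lt_i => /=; rewrite ltnS leq_eqVlt => /predU1P[->|lt_i].
  by rewrite modnn nth_default.
by rewrite modn_small //=; apply: set_nth_default.
Qed.

Section Matched.
Variable ps : seq passage.
Hypothesis mps : matched ps.

Lemma matched_mate p : (mate p \in ps) = (p \in ps).
Proof.
have sub q : q \in ps -> mate q \in ps by move=> qs; case/andP: (allP mps q qs).
by apply/idP/idP => /sub //; rewrite mateK.
Qed.

Lemma matched_count p : p \in ps -> count_mem (label p) (map label ps) = 2.
Proof. by move=> pps; case/andP: (allP mps p pps) => /eqP. Qed.

(** The label of [p] occurs twice, and the distinct passages [p] and [mate p] both carry it. *)
Lemma matched_count1 p : p \in ps -> count_mem p ps = 1.
Proof.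
move=> pps; have := matched_count pps; rewrite count_map.
have := count_predUI (pred1 p) (pred1 (mate p)) ps.
rewrite (@eq_count _ (predI _ _) pred0) ?count_pred0 ?addn0; last first.
  by move=> q /=; apply/andP => -[/eqP-> /eqP/esym/eqP]; rewrite (negPf (mate_neq p)).
move=> cU c2; have: count (predU (pred1 p) (pred1 (mate p))) ps <= 2.
  by rewrite -c2; apply: sub_count => q /= /orP[] /eqP->.
rewrite cU; have : 0 < count_mem p ps by rewrite -has_count has_pred1.
have : 0 < count_mem (mate p) ps by rewrite -has_count has_pred1 matched_mate.
by lia.
Qed.

Lemma matched_uniq : uniq ps.
Proof.
apply: count_mem_uniq => p; case: (boolP (p \in ps)) => [/matched_count1-> //|pps].
exact: count_memPn.
Qed.

Lemma matched_label p q : p \in ps -> q \in ps -> label p = label q ->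
  q != p -> q = mate p.
Proof.
move=> pps qps lpq npq; apply/eqP/negPn/negP => nq.
have := matched_count pps; rewrite count_map => c2.
have: count (predU (pred1 q) (predU (pred1 p) (pred1 (mate p)))) ps <= 2.
  by rewrite -c2; apply: sub_count => r /= /or3P[] /eqP-> //=; rewrite lpq.
have disj (a b : pred passage) : predI a b =1 pred0 ->
    count (predU a b) ps = count a ps + count b ps.
  by move=> ab; rewrite -count_predUI (eq_count ab) count_pred0 addn0.
rewrite !disj ?matched_count1 ?matched_mate //.
- by move=> r /=; apply/andP => -[/eqP-> /eqP/esym/eqP]; rewrite (negPf (mate_neq p)).
move=> r /=; apply/andP => -[/eqP->]; by rewrite (negPf npq) (negPf nq).
Qed.

Lemma dart_next_inj : injective (dart_next ps).
Proof.
have ups := matched_uniq; move=> [p b] [q c]; rewrite /dart_next /=.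
case: (boolP (dir p == b)) (boolP (dir q == c)) => [/eqP<-|pb] [/eqP<-|qc] //= [].
  by move=> /(can_inj (prev_next ups)) /(can_inj mateK) ->.
move=> /(can_inj (next_prev ups)) /(can_inj mateK) eqpq.
by rewrite eqpq in pb *; case: b c (dir q) pb qc => [] [] [].
Qed.

Definition arrival (e : 'I_(size ps) * bool) : dart :=
  (tnth (in_tuple ps) (if e.2 then ordS e.1 else e.1), e.2).

Lemma arrival_inj : injective arrival.
Proof.
have injt : injective (tnth (in_tuple ps)) by apply/tuple_uniqP/matched_uniq.
by move=> [i []] [j []] [] // /injt => [/(can_inj (@ordSK _))|] ->.
Qed.

Lemma codom_arrival d : (d \in codom arrival) = (d.1 \in ps).
Proof.
apply/codomP/idP => [[e ->]|]; first exact: mem_tnth.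
case: d => p b /= /(tnthP (in_tuple ps))[i ->].
exists (if b then ord_pred i else i, b); rewrite /arrival /=.
by case: b; rewrite ?ord_predK.
Qed.

Lemma tnth_other i : tnth (in_tuple ps) (other_place i) = mate (tnth (in_tuple ps) i).
Proof.
have injt : injective (tnth (in_tuple ps)) by apply/tuple_uniqP/matched_uniq.
rewrite /other_place; case: pickP => [j /andP[nji /eqP eq_l]|no] /=.
  apply: matched_label; rewrite ?mem_tnth //.
  by apply: contra nji => /eqP/injt->.
have : mate (tnth (in_tuple ps) i) \in ps by rewrite matched_mate mem_tnth.
case/(tnthP (in_tuple ps)) => j eq_j; have /negP[] := no j.
rewrite -eq_j eqxx andbT; apply/eqP => eq_ji.
by have /eqP[] := mate_neq (tnth (in_tuple ps) i); rewrite eq_j eq_ji.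
Qed.

Lemma tnth_ordS i : tnth (in_tuple ps) (ordS i) = next ps (tnth (in_tuple ps) i).
Proof.
pose x := tnth (in_tuple ps) i; rewrite !(tnth_nth x).
by rewrite next_nth_mod ?matched_uniq.
Qed.

Lemma tnth_ord_pred i :
  tnth (in_tuple ps) (ord_pred i) = prev ps (tnth (in_tuple ps) i).
Proof.
by rewrite -{2}[i](ord_predK) tnth_ordS prev_next // matched_uniq.
Qed.

Lemma arrival_face_next e : arrival (face_next e) = dart_next ps (arrival e).
Proof.
case: e => i b; rewrite /face_next /dart_next /arrival /=.
move: (if b then ordS i else i) => k.
by case: (dir _ == b) => /=; rewrite ?tnth_ordS ?tnth_ord_pred tnth_other.
Qed.

Lemma face_next_inj : injective (@face_next ps).
Proof.
move=> e1 e2 eq_e; apply/arrival_inj/dart_next_inj.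
by rewrite -!arrival_face_next eq_e.
Qed.

End Matched.

(** * Tangle replacement *)

Lemma next_cat (T : eqType) (s t : seq T) (x0 x : T) :
  uniq (s ++ t) -> x \in s -> t != [::] ->
  next (s ++ t) x =
  if (index x s).+1 < size s then nth x s (index x s).+1 else head x0 t.
Proof.
move=> u xs t0; have lt_x : index x s < size s by rewrite index_mem.
have lt_t : 0 < size t by case: (t) t0.
have {1}-> : x = nth x (s ++ t) (index x s) by rewrite nth_cat lt_x nth_index.
rewrite next_nth_mod // ?size_cat ?modn_small ?nth_cat; try by lia.
case: ltnP => // le_s; have -> : (index x s).+1 - size s = 0 by lia.
by case: (t) t0.
Qed.

Lemma prev_cat (T : eqType) (s t : seq T) (x0 x : T) :
  uniq (s ++ t) -> x \in s -> t != [::] ->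
  prev (s ++ t) x = if 0 < index x s then nth x s (index x s).-1 else last x0 t.
Proof.
move=> u xs t0; have lt_x : index x s < size s by rewrite index_mem.
have us : uniq s by move: u; rewrite cat_uniq => /andP[].
have s0 : s != [::] by case: (s) xs.
apply: (can_inj (prev_next u)); rewrite next_prev //.
case: posnP => [x_0|x_gt0].
  rewrite -(next_rot (size s)) // rot_size_cat (@next_cat _ _ _ x) //.
  - case: ifP => [|_]; last by rewrite -nth0 -x_0 nth_index.
    case: (t) u t0 => // y t'; rewrite cat_uniq => /and3P[_ _ ut] _.
    by rewrite [last _ _]/(last y t') index_last // ltnn.
  - by rewrite uniq_catC.
  - by case: (t) t0 => // y t' _; rewrite /= mem_last.
have lt_p : (index x s).-1 < size s by lia.
by rewrite (@next_cat _ _ _ x) ?mem_nth // index_uniq // prednK // lt_x nth_index.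
Qed.

Lemma matched_perm s t : perm_eq s t -> matched s = matched t.
Proof.
move=> st; rewrite /matched (perm_all _ st); apply: eq_all => p.
by rewrite (perm_mem st) (permP (perm_map label st)).
Qed.

Lemma matched_cat s t :
  {in map label s, forall c, c \notin map label t} ->
  matched (s ++ t) = matched s && matched t.
Proof.
move=> st; rewrite /matched all_cat; congr (_ && _).
  apply: eq_in_all => p ps; rewrite map_cat count_cat mem_cat.
  have nt : label p \notin map label t by apply/st/map_f.
  rewrite (count_memPn nt) addn0; case: (boolP (mate p \in t)); last by rewrite orbF.
  by move/(map_f label); rewrite (negPf nt).
apply: eq_in_all => p pt; rewrite map_cat count_cat mem_cat.
have ns : label p \notin map label s.
  by apply/negP => /st; rewrite map_f.
rewrite (count_memPn ns); case: (boolP (mate p \in s)) => //.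
by move/(map_f label); rewrite (negPf ns).
Qed.

Lemma dart_next_rot n ps : uniq ps -> dart_next (rot n ps) =1 dart_next ps.
Proof. by move=> u d; rewrite /dart_next next_rot // prev_rot. Qed.

Definition port := (bool * bool)%type.

(* A tangle is given by the passages [a1] and [a2] met on its two strands; the
   port [(s, b)] is the end (if [b]) or the start of the first (if [s]) or of
   the second strand. *)
Definition tangle_step (a1 a2 : seq passage) (d : dart) : dart + port :=
  let q := mate d.1 in
  let a := if q \in a1 then a1 else a2 in
  if dir d.1 == d.2 then
    if (index q a).+1 < size a then inl (nth q a (index q a).+1, true)
    else inr (q \in a1, true)
  else
    if 0 < index q a then inl (nth q a (index q a).-1, false)
    else inr (q \in a1, false).

(* The strands [u1] and [u2] complete the tangle to the knot a1 u1 a2 u2. *)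
Definition exit_dart (u1 u2 : seq passage) (p : port) : dart :=
  let x := Passage 0 Virtual true in
  if p.2 then (head x (if p.1 then u1 else u2), true)
  else (last x (if p.1 then u2 else u1), false).

(** Here [p] is a port of the outer tangle [(u1, u2)]. Read from [u1], the knot is u1 a2 u2 a1, so
    the inner strands complete it in the order [a2], [a1]. *)
Definition enter_dart (a1 a2 : seq passage) (p : port) := exit_dart a2 a1 p.

Fixpoint trace (a1 a2 : seq passage) n (d : dart) : seq dart * option port :=
  if n is n'.+1 then
    match tangle_step a1 a2 d with
    | inl d' => let: (s, p) := trace a1 a2 n' d' in (d :: s, p)
    | inr p => ([:: d], Some p)
    end
  else ([::], None).

(** The orbit searches are untrusted: nothing is proved about them, and their fuel only has to
    suffice in the instances evaluated. [tangle_ok] and [diagram_check] verify the lists found. *)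
Fixpoint orbit_search (step : dart -> option dart) n (d0 d : dart) : seq dart :=
  if n is n'.+1 then
    if step d is Some d' then
      d :: (if d' == d0 then [::] else orbit_search step n' d0 d')
    else [:: d]
  else [::].

Fixpoint orbits_search (step : dart -> option dart) n (ds : seq dart) :=
  if n is n'.+1 then
    if ds is d :: _ then
      let c := orbit_search step (size ds) d d in
      c :: orbits_search step n' [seq x <- ds | x \notin c]
    else [::]
  else [::].

Definition darts (ps : seq passage) : seq dart :=
  [seq (p, true) | p <- ps] ++ [seq (p, false) | p <- ps].

Lemma mem_darts ps d : (d \in darts ps) = (d.1 \in ps).
Proof.
case: d => p b; rewrite mem_cat.
by apply/orP/idP => /= [[] /mapP[q ? [-> _]] //|pps]; case: b; [left|right]; apply: map_f.
Qed.

Section Tangle.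
Variables a1 a2 : seq passage.
Local Notation a := (a1 ++ a2).

Definition traces :=
  [seq trace a1 a2 (size (darts a)) (enter_dart a1 a2 p)
  | p <- [:: (true, true); (true, false); (false, true); (false, false)]].

Definition traced : seq dart := flatten [seq t.1 | t <- traces].

Definition inner_faces : seq (seq dart) :=
  let tr := traced in
  let step d := if tangle_step a1 a2 d is inl d' then Some d' else None in
  orbits_search step (size (darts a)) [seq d <- darts a | d \notin tr].

(** A certificate: the listed cycles are disjoint faces closed up inside the tangle, and each
    remaining dart lies on a trace that starts and ends at ports. The even size makes halves of
    sizes add up in Euler's formula. *)
Definition tangle_ok : bool :=
  let tr := traced in let cs := inner_faces in let inner := flatten cs in
  [&& [&& a1 != [::], a2 != [::], matched a & ~~ odd (size a)],
      all (fun t => t.2 != None) traces,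
      all (fun c => (c != [::]) && cycle (fun d e => tangle_step a1 a2 d == inl e) c)
        cs,
      uniq inner &
      all (mem (darts a)) inner &&
      all (fun d => (d \in tr) || (d \in inner)) (darts a)].

Hypothesis ma : matched a.
Variables u1 u2 : seq passage.
Hypotheses (u1_0 : u1 != [::]) (u2_0 : u2 != [::]).
Hypothesis disj : {in map label a, forall c, c \notin map label (u1 ++ u2)}.
Hypothesis mu : matched (u1 ++ u2).
Local Notation ps := (a1 ++ u1 ++ a2 ++ u2).

Lemma perm_tangle : perm_eq ps (a ++ u1 ++ u2).
Proof. by rewrite -!catA perm_cat2l perm_catCA. Qed.

Lemma matched_tangle : matched ps.
Proof. by rewrite (matched_perm perm_tangle) matched_cat // ma mu. Qed.

Lemma tangle_stepE d : d.1 \in a ->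
  dart_next ps d =
  match tangle_step a1 a2 d with inl d' => d' | inr p => exit_dart u1 u2 p end.
Proof.
move=> da; have ups := matched_uniq matched_tangle.
have := da; rewrite -(matched_mate ma) mem_cat => qa.
rewrite /dart_next /tangle_step /exit_dart; set q := mate d.1 in qa *.
case: (boolP (q \in a1)) qa => [q1 _|_ /= q2].
  have n0 : u1 ++ a2 ++ u2 != [::] by case: (u1) u1_0.
  case: eqP => _.
    rewrite (next_cat (Passage 0 Virtual true) ups q1 n0).
    by case: ifP => //= _; case: (u1) u1_0.
  rewrite (prev_cat (Passage 0 Virtual true) ups q1 n0).
  by case: ifP => //= _; rewrite !last_cat; case: (u2) u2_0.
(* The second strand is reduced to the first by rotating the knot so that [a2] comes in front. *)
have n0 : u2 ++ a1 ++ u1 != [::] by case: (u2) u2_0.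
have def_r : rot (size (a1 ++ u1)) ps = a2 ++ u2 ++ a1 ++ u1.
  by rewrite catA rot_size_cat -!catA.
have ur : uniq (a2 ++ u2 ++ a1 ++ u1) by rewrite -def_r rot_uniq.
rewrite -(next_rot (size (a1 ++ u1)) ups) -(prev_rot (size (a1 ++ u1)) ups) def_r.
case: eqP => _.
  rewrite (next_cat (Passage 0 Virtual true) ur q2 n0).
  by case: ifP => //= _; case: (u2) u2_0.
rewrite (prev_cat (Passage 0 Virtual true) ur q2 n0).
by case: ifP => //= _; rewrite !last_cat; case: (u1) u1_0.
Qed.

Lemma tangle_step_in d d' : d.1 \in a -> tangle_step a1 a2 d = inl d' -> d'.1 \in a.
Proof.
move=> da; have qa : mate d.1 \in a by rewrite (matched_mate ma).
rewrite /tangle_step; set q := mate _ in qa *; set b := if q \in a1 then a1 else a2.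
have sub x : x \in b -> x \in a by rewrite mem_cat /b; case: ifP => _ ->; rewrite ?orbT.
have lt : index q b < size b.
  by rewrite index_mem /b; case: ifP qa => //; rewrite mem_cat => ->.
clearbody b q; clear da qa.
case: eqP => _; case: ifP => // lt' [<-]; apply: sub.
  exact: (mem_nth q lt').
exact: (mem_nth q (leq_ltn_trans (leq_pred _) lt)).
Qed.

Lemma traceP n d s p : d.1 \in a -> trace a1 a2 n d = (s, Some p) ->
  exists s', [/\ s = d :: s', fpath (dart_next ps) d (rcons s' (exit_dart u1 u2 p))
    & all (fun e => e.1 \in a) s].
Proof.
elim: n d s => // n IH d s da /=; have := tangle_stepE da.
case def_d: (tangle_step a1 a2 d) => [d'|p'] Fd; last first.
  by case=> <- <-; exists [::]; rewrite /= Fd eqxx da.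
have d'a := tangle_step_in da def_d.
case def_t: (trace a1 a2 n d') => [s1 p1] [<- def_p].
rewrite {}def_p in def_t; have [s' [-> Fs' as']] := IH _ _ d'a def_t.
by exists (d' :: s'); split; rewrite //= ?Fd ?eqxx ?da.
Qed.

End Tangle.

Section TangleFaces.
Variables a1 a2 : seq passage.
Local Notation a := (a1 ++ a2).
Hypothesis ok : tangle_ok a1 a2.
Variables u1 u2 : seq passage.
Hypotheses (u1_0 : u1 != [::]) (u2_0 : u2 != [::]).
Hypothesis disj : {in map label a, forall c, c \notin map label (u1 ++ u2)}.
Hypothesis mu : matched (u1 ++ u2).
Local Notation ps := (a1 ++ u1 ++ a2 ++ u2).

Lemma tangle_nil1 : a1 != [::]. Proof. by case/and5P: ok => /and4P[]. Qed.
Lemma tangle_nil2 : a2 != [::]. Proof. by case/and5P: ok => /and4P[]. Qed.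
Lemma tangle_matched : matched a. Proof. by case/and5P: ok => /and4P[]. Qed.
Let mps : matched ps := matched_tangle tangle_matched disj mu.

Lemma enter_dart_in p : (enter_dart a1 a2 p).1 \in a.
Proof.
have := tangle_nil1; have := tangle_nil2; rewrite mem_cat /enter_dart /exit_dart.
by case: (a1) (a2) p => [|x s] [|y t] [[] []] //= _ _; rewrite ?mem_head ?mem_last ?orbT.
Qed.

Lemma exit_dart_in p : (exit_dart u1 u2 p).1 \in u1 ++ u2.
Proof.
move: u1_0 u2_0; rewrite mem_cat /exit_dart.
by case: (u1) (u2) p => [|x s] [|y t] [[] []] //= _ _; rewrite ?mem_head ?mem_last ?orbT.
Qed.

Lemma outer_notin x : x \in u1 ++ u2 -> x \notin a.
Proof.
by move=> xu; apply/negP => xa; have := disj (map_f label xa); rewrite map_f.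
Qed.

(** Inside and outside play symmetric roles: after a rotation this is [tangle_stepE] for the tangle
    [(u1, u2)]. *)
Lemma outer_step d : d.1 \in u1 ++ u2 ->
  dart_next ps d =
  match tangle_step u1 u2 d with inl d' => d' | inr p => enter_dart a1 a2 p end.
Proof.
have ups := matched_uniq mps.
rewrite -(dart_next_rot (size a1) ups) rot_size_cat -!catA; apply: tangle_stepE.
- exact: mu.
- exact: tangle_nil2.
- exact: tangle_nil1.
- move=> c cu; apply/negP; rewrite map_cat mem_cat orbC -mem_cat -map_cat => /disj.
  by rewrite cu.
by rewrite (matched_perm (permEl (perm_catC _ _))) tangle_matched.
Qed.

Definition port_trace p := trace a1 a2 (size (darts a)) (enter_dart a1 a2 p).

Definition port_exit p := odflt (true, true) (port_trace p).2.

Lemma port_trace_exit p : port_trace p = ((port_trace p).1, Some (port_exit p)).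
Proof.
case/and5P: ok => _ /allP tr _ _ _.
have /tr : port_trace p \in traces a1 a2.
  by apply: map_f; case: p => [[] []].
by rewrite /port_exit; case: (port_trace p) => s [].
Qed.

(** The inner strands enter the result only through [port_exit], so tangles with equal exits have
    the same first returns. *)
Lemma tangle_return d : d.1 \in u1 ++ u2 ->
  first_return (dart_next ps) (mem (darts (u1 ++ u2))) d
    (match tangle_step u1 u2 d with
     | inl d' => d'
     | inr p => exit_dart u1 u2 (port_exit p)
     end).
Proof.
move=> du; have := outer_step du.
case def_d: (tangle_step u1 u2 d) => [d'|p] Fd.
  split; first by rewrite /= mem_darts (tangle_step_in mu du def_d).
  by exists [::]; rewrite //= Fd eqxx.
split; first by rewrite /= mem_darts exit_dart_in.
have [s' [def_s Fs as_]] :=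
  traceP tangle_matched u1_0 u2_0 disj mu (enter_dart_in p) (port_trace_exit p).
exists (enter_dart a1 a2 p :: s'); first by rewrite /= Fd eqxx.
rewrite -def_s; apply: sub_all as_ => e ea /=.
by rewrite mem_darts; apply: contraL ea; apply: outer_notin.
Qed.

Lemma traced_exit d : d \in traced a1 a2 ->
  exists n, iter n (dart_next ps) d \in darts (u1 ++ u2).
Proof.
case/flattenP=> _ /mapP[_ /mapP[p _ ->] ->] /=; rewrite -/(port_trace p) => ds.
have [s' [def_s /= Fs _]] :=
  traceP tangle_matched u1_0 u2_0 disj mu (enter_dart_in p) (port_trace_exit p).
move: ds; rewrite def_s => ds.
have /fpathP[k def_s'] := Fs.
pose E := enter_dart a1 a2 p.
have lst : last E (rcons s' (exit_dart u1 u2 (port_exit p))) = iter k (dart_next ps) E.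
  by rewrite def_s' last_traject.
rewrite last_rcons in lst.
have [i le_ik def_d] : exists2 i, i <= k & d = iter i (dart_next ps) E.
  move: ds; rewrite in_cons => /predU1P[->|ds]; first by exists 0.
  have : d \in rcons s' (exit_dart u1 u2 (port_exit p)) by rewrite mem_rcons in_cons ds orbT.
  by rewrite def_s' => /trajectP[i lt_ik ->]; exists i.+1; rewrite ?iterSr.
exists (k - i); rewrite def_d -iterD subnK // -lst mem_darts; exact: exit_dart_in.
Qed.

(** A face that stays inside the tangle contains no traced dart, as those reach the outside, so it
    is a listed cycle; conversely a listed cycle never leaves the tangle. *)
Lemma nfaces_tangle :
  fcard (@face_next ps) predT =
    fcard (@face_next ps) (meets (darts (u1 ++ u2)) (@face_next ps) (@arrival ps))
    + size (inner_faces a1 a2).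
Proof.
case/and5P: (ok) => _ _ cyc ucs /andP[/allP cs_a /allP a_cs].
have injf := face_next_inj mps; have injr := arrival_inj mps.
have rf := arrival_face_next mps.
rewrite (n_compC (meets (darts (u1 ++ u2)) (@face_next ps) (@arrival ps))).
congr (_ + _).
have ia x : x \in a -> x \in ps.
  by move=> xa; rewrite (perm_mem (perm_tangle a1 a2 u1 u2)) mem_cat xa.
have Fcs c : c \in inner_faces a1 a2 -> fcycle (dart_next ps) c.
  move=> cc; have /andP[_ Cc] := allP cyc c cc.
  apply: (sub_in_cycle (P := mem (darts a))) Cc; last first.
    by apply/allP => d dc; apply: cs_a; apply/flattenP; exists c.
  move=> d e /=; rewrite mem_darts => da _ /eqP st.
  by rewrite /= (tangle_stepE tangle_matched u1_0 u2_0 disj mu da) st.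
rewrite -(fcard_cycles injf injr rf (cs := inner_faces a1 a2)) //.
- apply: eq_n_comp_r => t; rewrite !inE; apply/negP/idP => [nmeet|].
    have tps : (arrival t).1 \in ps by rewrite -codom_arrival // codom_f.
    have := tps; rewrite (perm_mem (perm_tangle a1 a2 u1 u2)) mem_cat => /orP[ta|tu].
      have := a_cs (arrival t); rewrite mem_darts ta => /(_ isT) /orP[] //.
      case/traced_exit => n En; case: nmeet.
      apply/existsP; exists (iter n (@face_next ps) t).
      by rewrite fconnect_iter (iter_semiconj rf).
    by case: nmeet; apply/existsP; exists t; rewrite connect0 mem_darts.
  case/flattenP => c cc tc /existsP[s /andP[/(fconnectP_semiconj injr rf)[n <-]]].
  have /cs_a : iter n (dart_next ps) (arrival t) \in flatten (inner_faces a1 a2).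
    by apply/flattenP; exists c; rewrite // (fcycle_iter _ (Fcs _ cc)).
  by rewrite /= !mem_darts => ?; move/outer_notin/negP.
- by apply/allP => c cc; have /andP[-> _] := allP cyc c cc; apply: Fcs.
by move=> d /cs_a /=; rewrite mem_darts codom_arrival // => /ia.
Qed.

End TangleFaces.

(** The last equation, free of subtraction, says that inner faces minus double points agree. This is
    the contribution of the tangle to F - V, which is the Euler characteristic because E = 2V. *)
Definition tangle_equiv (a1 a2 b1 b2 : seq passage) : bool :=
  [&& tangle_ok a1 a2, tangle_ok b1 b2,
      [seq t.2 | t <- traces a1 a2] == [seq t.2 | t <- traces b1 b2] &
      size (inner_faces a1 a2) + (size (b1 ++ b2))./2 ==
      size (inner_faces b1 b2) + (size (a1 ++ a2))./2].

Section Replace.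
Variables a1 a2 b1 b2 u1 u2 : seq passage.
Hypothesis eq_ab : tangle_equiv a1 a2 b1 b2.
Hypotheses (u1_0 : u1 != [::]) (u2_0 : u2 != [::]).
Hypothesis disj_a :
  {in map label (a1 ++ a2), forall c, c \notin map label (u1 ++ u2)}.
Hypothesis disj_b :
  {in map label (b1 ++ b2), forall c, c \notin map label (u1 ++ u2)}.
Hypothesis mu : matched (u1 ++ u2).
Local Notation pa := (a1 ++ u1 ++ a2 ++ u2).
Local Notation pb := (b1 ++ u1 ++ b2 ++ u2).

Lemma same_port_exit p : port_exit a1 a2 p = port_exit b1 b2 p.
Proof.
case/and4P: eq_ab => _ _ /eqP eqt _; rewrite /port_exit; congr odflt.
case: eqt; rewrite -!/(port_trace _ _ _).
by case: p => [[] []] //.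
Qed.

Lemma euler_tangle :
  (fcard (@face_next pa) predT == (size pa)./2 + 2) =
  (fcard (@face_next pb) predT == (size pb)./2 + 2).
Proof.
case/and4P: eq_ab => oka okb _ /eqP eqn.
rewrite (nfaces_tangle oka u1_0 u2_0 disj_a mu) (nfaces_tangle okb u1_0 u2_0 disj_b mu).
have ma := matched_tangle (tangle_matched oka) disj_a mu.
have mb := matched_tangle (tangle_matched okb) disj_b mu.
have half (c1 c2 : seq passage) : tangle_ok c1 c2 ->
    (size (c1 ++ u1 ++ c2 ++ u2))./2 = (size (c1 ++ c2))./2 + (size (u1 ++ u2))./2.
  case/and5P=> /and4P[_ _ _ ev] _ _ _ _.
  rewrite (perm_size (perm_tangle c1 c2 u1 u2)) (size_cat (c1 ++ c2)) halfD.
  by rewrite (negPf ev).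
have arith x y1 y2 s1 s2 h : y1 + s2 = y2 + s1 ->
    (x + y1 == s1 + h + 2) = (x + y2 == s2 + h + 2).
  by move=> eq_y; apply/eqP/eqP; lia.
rewrite !half // (fcard_same_return (face_next_inj ma) (arrival_inj ma)
  (face_next_inj mb) (arrival_inj mb) (arrival_face_next ma) (arrival_face_next mb)).
- exact: arith eqn.
- move=> d; rewrite mem_darts codom_arrival // => du.
  by rewrite (perm_mem (perm_tangle a1 a2 u1 u2)) mem_cat du orbT.
- move=> d; rewrite mem_darts codom_arrival // => du.
  by rewrite (perm_mem (perm_tangle b1 b2 u1 u2)) mem_cat du orbT.
move=> d; rewrite mem_darts => du.
have := tangle_return oka u1_0 u2_0 disj_a mu du.
have := tangle_return okb u1_0 u2_0 disj_b mu du.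
case: (tangle_step u1 u2 d) => [d'|p]; first by exists d'.
by rewrite -same_port_exit => ? ?; exists (exit_dart u1 u2 (port_exit a1 a2 p)).
Qed.

End Replace.

Lemma labels_cat (s t : word) : labels (s ++ t) = labels s ++ labels t.
Proof. by rewrite /labels /passages pmap_cat map_cat. Qed.

Lemma passages_cat (s t : word) : passages (s ++ t) = passages s ++ passages t.
Proof. exact: pmap_cat. Qed.

Lemma diagram_tangle (a1 a2 b1 b2 u1 u2 : word) :
  tangle_equiv (passages a1) (passages a2) (passages b1) (passages b2) ->
  passages u1 != [::] -> passages u2 != [::] ->
  all (fun c => (c \notin labels (a1 ++ a2)) && (c \notin labels (b1 ++ b2)))
    (labels (u1 ++ u2)) ->
  diagram (a1 ++ u1 ++ a2 ++ u2) -> diagram (b1 ++ u1 ++ b2 ++ u2).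
Proof.
move=> eq_ab u1_0 u2_0 /allP disj /andP[wfa pla].
have da : {in map label (passages a1 ++ passages a2),
    forall c, c \notin map label (passages u1 ++ passages u2)}.
  move=> c ca; apply/negP; rewrite -passages_cat => /disj.
  by rewrite /labels passages_cat ca.
have db : {in map label (passages b1 ++ passages b2),
    forall c, c \notin map label (passages u1 ++ passages u2)}.
  move=> c cb; apply/negP; rewrite -passages_cat => /disj.
  by rewrite /labels !passages_cat cb andbF.
have mu : matched (passages u1 ++ passages u2).
  move: wfa; rewrite -[well_formed _]/(matched (passages _)) !passages_cat.
  by rewrite (matched_perm (perm_tangle _ _ _ _)) matched_cat // => /andP[].
case/and4P: (eq_ab) => oka okb _ _.
apply/andP; split.
  rewrite -[well_formed _]/(matched (passages _)) !passages_cat.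
  exact: (matched_tangle (tangle_matched okb) db mu).
move: pla; rewrite /planar !passages_cat.
rewrite (euler_tangle eq_ab u1_0 u2_0 da db mu) => /orP[|->]; last by rewrite orbT.
by case: (passages a1) (tangle_nil1 oka).
Qed.

(** * Isotopy and closed diagrams *)

Lemma next_map_in (T U : eqType) (g : T -> U) s x :
  uniq (map g s) -> x \in s -> next (map g s) (g x) = g (next s x).
Proof.
move=> ugs xs; have us := map_uniq ugs; have lt_x : index x s < size s by rewrite index_mem.
rewrite -{1 2}(nth_index x xs) next_nth_mod // -(nth_map x (g x)) //.
rewrite next_nth_mod ?size_map // (nth_map x) //.
by rewrite ltn_mod; case: (s) xs.
Qed.

Lemma prev_map_in (T U : eqType) (g : T -> U) s x :
  uniq (map g s) -> x \in s -> prev (map g s) (g x) = g (prev s x).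
Proof.
move=> ugs xs; have us := map_uniq ugs.
apply: (can_inj (prev_next ugs)); rewrite next_prev // next_map_in ?mem_prev //.
by rewrite next_prev.
Qed.

Lemma passages_map (g : passage -> passage) w :
  passages (map (omap g) w) = map g (passages w).
Proof. by elim: w => //= -[p|] w /= ->. Qed.

Lemma rot_passages n w :
  passages (rot n w) = rot (size (passages (take n w))) (passages w).
Proof.
rewrite -[X in _ = rot _ (passages X)](cat_take_drop n w) passages_cat rot_size_cat.
exact: passages_cat.
Qed.

Lemma labels_map f w : labels (map (omap (relabel f)) w) = map f (labels w).
Proof. by rewrite /labels passages_map -!map_comp. Qed.

Lemma planarE w : planar w =
  (passages w == [::]) ||
  (fcard (@face_next (passages w)) predT == (size (passages w))./2 + 2).
Proof. by []. Qed.

Lemma diagram_rot n w : diagram w -> diagram (rot n w).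
Proof.
case/andP=> mw pw; set m := size (passages (take n w)).
have prm : perm_eq (passages (rot n w)) (passages w).
  by rewrite rot_passages perm_rot.
have mr : matched (passages (rot n w)) by rewrite (matched_perm prm).
apply/andP; split=> //; move: pw; rewrite !planarE.
have -> : (passages (rot n w) == [::]) = (passages w == [::]).
  by rewrite -!size_eq0 (perm_size prm).
suff -> : fcard (@face_next (passages (rot n w))) predT =
    fcard (@face_next (passages w)) predT by rewrite (perm_size prm).
apply/esym/(fcard_same_codom (face_next_inj mw) (arrival_inj mw) (face_next_inj mr)
  (arrival_inj mr) (arrival_face_next mw)).
  move=> t; rewrite arrival_face_next //; move: (arrival t) => d.
  rewrite rot_passages dart_next_rot //.
  exact: matched_uniq.
by move=> d; rewrite !codom_arrival // (perm_mem prm).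
Qed.

Lemma diagram_relabel f w : {in labels w &, injective f} ->
  diagram w -> diagram (map (omap (relabel f)) w).
Proof.
move=> injf /andP[mw pw]; set ps := passages w in mw pw.
have injg : {in ps &, injective (relabel f)}.
  move=> [c l d] [c' l' d'] cps cps' [eqc -> ->]; congr Passage.
  by apply: injf eqc; [apply: (map_f label cps)|apply: (map_f label cps')].
have gE : passages (map (omap (relabel f)) w) = map (relabel f) ps by apply: passages_map.
have mg : matched (map (relabel f) ps).
  apply/allP => _ /mapP[p pps ->]; have /andP[/eqP c2 mp] := allP mw p pps.
  rewrite (map_f (relabel f) mp) andbT -map_comp.
  have -> : map (label \o relabel f) ps = map f (map label ps) by rewrite -map_comp.
  rewrite /= !count_map -c2 count_map; apply/eqP/eq_in_count => q qps /=.
  apply/eqP/eqP => [/injf|-> //]; apply; exact: map_f.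
apply/andP; split; first by rewrite -[well_formed _]/(matched (passages _)) gE.
move: pw; rewrite !planarE gE -/ps.
have ug := matched_uniq mg.
(* The old edges are read with the new names, so that both face maps are compared with [dart_next]
   of the renamed list. *)
pose r (e : 'I_(size ps) * bool) : dart := (relabel f (arrival e).1, e.2).
have -> : (map (relabel f) ps == [::]) = (ps == [::]) by case: (ps).
suff -> : fcard (@face_next (map (relabel f) ps)) predT = fcard (@face_next ps) predT.
  by rewrite size_map.
apply/esym/(@fcard_same_codom _ _ _ _ _ r _ _ (face_next_inj mw) _ (face_next_inj mg)
  (arrival_inj mg) _ (arrival_face_next mg)).
- move=> e1 e2 eq_r; apply: (arrival_inj mw).
  have /= := congr1 snd eq_r; have := congr1 fst eq_r => /=.
  move=> /injg; rewrite !mem_tnth => /(_ isT isT) eq1 eq2.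
  by rewrite [LHS]surjective_pairing [RHS]surjective_pairing /= eq1 eq2.
- move=> e; have mp : mate (arrival e).1 \in ps by rewrite matched_mate // mem_tnth.
  have := arrival_face_next mw e; rewrite /r /dart_next /=.
  case: ifP => _ [-> ->].
    by rewrite -next_map_in.
  by rewrite -prev_map_in.
move=> d; rewrite codom_arrival //; apply/codomP/mapP => [[e ->]|[p pps def_d]].
  by exists (arrival e).1; rewrite // mem_tnth.
have /codomP[e def_e] : (p, d.2) \in codom (@arrival ps) by rewrite codom_arrival.
exists e; rewrite /r -def_e /= -def_d; case: d def_e {def_d} => q b [_ -> /=].
by [].
Qed.

Lemma diagram_isotopic w w' : isotopic w w' -> diagram w -> diagram w'.
Proof.
case=> n [f [injf ->]] dw; apply: diagram_relabel; last exact: diagram_rot.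
have prm : perm_eq (labels (rot n w)) (labels w).
  by rewrite /labels rot_passages map_rot perm_rot.
by move=> c c'; rewrite !(perm_mem prm); apply: injf.
Qed.

Definition all_faces (ps : seq passage) : seq (seq dart) :=
  orbits_search (fun d => Some (dart_next ps d)) (size (darts ps)) (darts ps).

Definition diagram_check (w : word) : bool :=
  let ps := passages w in let cs := all_faces ps in let ds := flatten cs in
  [&& matched ps, all (fun c => (c != [::]) && fcycle (dart_next ps) c) cs,
      uniq ds, all (mem (darts ps)) ds &
      all (mem ds) (darts ps) && (size cs == (size ps)./2 + 2)].

Lemma diagram_checkP w : diagram_check w -> diagram w.
Proof.
case/and5P => mw cyc ucs /allP sub /andP[/allP sup /eqP szc].
apply/andP; split=> //; rewrite planarE; apply/orP; right.
rewrite -szc -(fcard_cycles (face_next_inj mw) (arrival_inj mw) (arrival_face_next mw) cyc) //.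
  apply/eqP/eq_n_comp_r => t; rewrite !inE; apply/esym/sup.
  by rewrite mem_darts mem_tnth.
by move=> d /sub; rewrite /= mem_darts codom_arrival.
Qed.

(** * Unknotting D_n *)

Local Notation relabelw f := (map (omap (relabel f))).

Lemma equivalent_trans w1 w2 w3 :
  equivalent w1 w2 -> equivalent w2 w3 -> equivalent w1 w3.
Proof. exact: rst_trans. Qed.

Lemma equivalent_isotopic w w' : diagram w -> isotopic w w' -> equivalent w w'.
Proof.
by move=> dw iso; apply: rst_step; split=> //; [apply: diagram_isotopic dw|left].
Qed.

Lemma relabelw_id w : relabelw id w = w.
Proof. by rewrite -[RHS]map_id; apply: eq_map => -[[]|]. Qed.

Lemma isotopic_rot n w : isotopic w (rot n w).
Proof. by exists n, id; split; rewrite ?relabelw_id. Qed.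

Lemma equivalent_rot n w : diagram w -> equivalent w (rot n w).
Proof. by move=> dw; apply: equivalent_isotopic (isotopic_rot n w). Qed.

Lemma equivalent_move i j w w' z z' : diagram w -> diagram w' ->
  rot i w = z -> rot j w' = z' -> move z z' -> equivalent w w'.
Proof.
move=> dw dw' <- <- mv; apply: equivalent_trans (equivalent_rot i dw) _.
apply: equivalent_trans (rst_sym _ _ _ _ (equivalent_rot j dw')).
by apply: rst_step; split; [apply: diagram_rot|apply: diagram_rot|right].
Qed.

Lemma transforms_equivalent k w w1 w2 :
  equivalent w w1 -> transforms k w1 w2 -> transforms k w w2.
Proof.
move=> eq01 t12; case: t12 eq01 => [w3 w4 eq34|k' w3 w4 w5 w6 eq34 sh t] eq.
  exact/transforms0/(equivalent_trans eq eq34).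
exact: transformsS (equivalent_trans eq eq34) sh t.
Qed.

Ltac bigon_tac :=
  solve [by exists true, true | by exists true, false
        | by exists false, true | by exists false, false].

Local Notation ov c d := (pass c Over d).
Local Notation un c d := (pass c Under d).
Local Notation vi c d := (pass c Virtual d).

(** [tail_h] and [tail_v] are the strands outside the tangle made of a_1 and the bars after its two
    passages. Each ends at the crossing of the connecting curves. The induction on [m] alters only
    that tangle. *)
Definition tail_h m : word :=
  flatten [seq [:: un (la j.+1) false; vi (lv j) true] | j <- iota 1 (m.*2 - 2)] ++
  [:: bar; un (la m.*2) false; vi (lv 0) true].
Definition tail_v m : word :=
  flatten [seq [:: ov (la j.+1) true; vi (lv j) false] | j <- iota 1 (m.*2 - 2)] ++
  [:: ov (la m.*2) true; vi (lv 0) false].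

Lemma D_tails m : D m = [:: ov 2 true; bar] ++ tail_h m ++ [:: un 2 false; bar] ++ tail_v m.
Proof. by rewrite /D /D_horizontal /D_vertical /tail_h /tail_v -!catA. Qed.

(* In D_(m+1), with labels increased by 2, the passages 4, 6 and 8 belong to a_1,
   a_2 and a_3, and 5 and 7 to the virtual crossings next to a_2 and a_3; [spread]
   moves the labels of D_m out of the way, also of the new crossings 0 and 1. *)
Definition spread (c : nat) : nat := if c <= 2 then c + 2 else c + 6.

Lemma spread_inj : injective spread.
Proof. by move=> c c'; rewrite /spread; case: ifP; case: ifP; lia. Qed.

Definition outer_h m : word := relabelw spread (tail_h m).
Definition outer_v m : word := relabelw spread (tail_v m).

(** Beyond a_3, an index in [D m.+1] exceeds the corresponding one in [D m] by 2, hence a label by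
    4; with the common shift by 2 this makes the 6 of [spread]. *)
Lemma relabel_D_succ m : 0 < m ->
  relabelw (addn 2) (D m.+1) =
  [:: ov 4 true; bar; un 6 false; vi 5 true; un 8 false; vi 7 true] ++ outer_h m ++
  [:: un 4 false; bar; ov 6 true; vi 5 false; ov 8 true; vi 7 false] ++ outer_v m.
Proof.
move=> m0; rewrite D_tails /tail_h /tail_v.
have -> : m.+1.*2 - 2 = (m.*2 - 2).+2 by lia.
have -> k : iota 1 k.+2 = [:: 1, 2 & map (addn 2) (iota 1 k)] by rewrite -iotaDl.
rewrite /=.
rewrite /outer_h /outer_v /tail_h /tail_v !map_cat /= !map_cat /= !map_flatten -!map_comp /=.
have shift l d e :
  flatten [seq (relabelw (addn 2) \o
      (fun j => [:: pass (la j.+1) l d; vi (lv j) e]) \o addn 2) j | j <- iota 1 (m.*2 - 2)] =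
  flatten [seq (relabelw spread \o
      (fun j => [:: pass (la j.+1) l d; vi (lv j) e])) j | j <- iota 1 (m.*2 - 2)].
  congr flatten; apply/eq_in_map => j; rewrite mem_iota => /andP[j0 _].
  rewrite /= /relabel /= /spread /la /lv; do 2!(case: ifP; first by lia); move=> _ _.
  by congr [:: pass _ l d; vi _ e]; lia.
rewrite !shift /=.
have -> : relabel (addn 2) (Passage (la m.+1.*2) Under false) =
  relabel spread (Passage (la m.*2) Under false).
  by rewrite /relabel /spread /la /=; case: ifP => [|_]; [|congr Passage]; lia.
have -> // : relabel (addn 2) (Passage (la m.+1.*2) Over true) =
  relabel spread (Passage (la m.*2) Over true).
by rewrite /relabel /spread /la /=; case: ifP => [|_]; [|congr Passage]; lia.
Qed.

Lemma relabel_D m : 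
  relabelw spread (D m) =
  [:: ov 4 true; bar] ++ outer_h m ++ [:: un 4 false; bar] ++ outer_v m.
Proof. by rewrite D_tails /= map_cat. Qed.

(** This leaves 0, 1, 2 and 4 to 8 to the tangle; 3 is the crossing of the connecting curves. *)
Lemma outer_labels m : 0 < m ->
  all (fun c => (c == 3) || (8 < c)) (labels (outer_h m ++ outer_v m)).
Proof.
move=> m0; rewrite labels_cat /outer_h /outer_v !labels_map -map_cat all_map.
have sp c : (c == 1) || (2 < c) -> (spread c == 3) || (8 < spread c).
  by rewrite /spread => /orP[/eqP-> //|c2]; rewrite leqNgt c2 /=; lia.
apply: (@sub_all _ (fun c => (c == 1) || (2 < c))) => [c /sp //|].
rewrite all_cat /tail_h /tail_v !labels_cat !all_cat /=.
have fl l d e s : all (leq 1) s -> all (fun c => (c == 1) || (2 < c))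
    (labels (flatten [seq [:: pass (la j.+1) l d; vi (lv j) e] | j <- s])).
  elim: s => //= j s IH /andP[j0 /IH]; rewrite /= => ->.
  by rewrite /la /lv; lia.
rewrite !fl ?/la; try by lia.
all: by apply/allP => j; rewrite mem_iota => /andP[].
Qed.

Lemma passages_outer_h m : passages (outer_h m) != [::].
Proof. by rewrite /outer_h passages_map /tail_h passages_cat; case: (passages _). Qed.

Lemma passages_outer_v m : passages (outer_v m) != [::].
Proof. by rewrite /outer_v passages_map /tail_v passages_cat; case: (passages _). Qed.

Lemma outer_avoid m (s : seq nat) : 0 < m -> all (fun c => (c != 3) && (c < 9)) s ->
  forall c, c \in labels (outer_h m ++ outer_v m) -> c \notin s.
Proof.
move=> m0 /allP as_ c /(allP (outer_labels m0)) c3; apply/negP => /as_.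
by case/orP: c3 => [/eqP->|]; lia.
Qed.

Lemma diagram_inner m (a1 a2 b1 b2 : word) : 0 < m ->
  tangle_equiv (passages a1) (passages a2) (passages b1) (passages b2) ->
  all (fun c => (c != 3) && (c < 9)) (labels (a1 ++ a2 ++ b1 ++ b2)) ->
  diagram (a1 ++ outer_h m ++ a2 ++ outer_v m) ->
  diagram (b1 ++ outer_h m ++ b2 ++ outer_v m).
Proof.
move=> m0 eq_ab lab; apply: diagram_tangle => //.
- exact: passages_outer_h.
- exact: passages_outer_v.
move: lab; rewrite catA labels_cat all_cat => /andP[la_ lb_].
by apply/allP => c cX; rewrite !(outer_avoid m0 _ cX).
Qed.

(** Going from [D m] to [D m.+1] exchanges the tangle a_1 for a_1 followed by four more crossings, a
    replacement verified by computation. *)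
Lemma diagram_D m : 0 < m -> diagram (D m).
Proof.
elim: m => // -[_ _|m /(_ isT) IH _]; first by apply: diagram_checkP; vm_compute.
have inj2 : injective (addn 2) by move=> x y; lia.
have d2 : diagram (relabelw (addn 2) (D m.+2)).
  rewrite relabel_D_succ //.
  apply: (diagram_inner (a1 := [:: ov 4 true; bar]) (a2 := [:: un 4 false; bar])) => //.
  by rewrite -relabel_D; apply: diagram_relabel IH; move=> c c' _ _ /spread_inj.
(* Subtracting 2 takes the shifted labels back to those of [D m.+2]. *)
have e : omap (relabel (subn^~ 2)) \o omap (relabel (addn 2)) =1 id.
  by case=> // -[c l d]; rewrite /= /relabel /= addKn.
have := @diagram_relabel (subn^~ 2) _ _ d2; rewrite -map_comp (eq_map e) map_id.
apply=> c c'; rewrite labels_map => /mapP[x _ ->] /mapP[y _ ->].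
by rewrite !addKn => ->.
Qed.

Lemma labels_rot n w : perm_eq (labels (rot n w)) (labels w).
Proof. by rewrite /labels rot_passages map_rot perm_rot. Qed.

Lemma relabel_flip_outer m s w : 0 < m -> all (fun c => (c != 3) && (c < 9)) s ->
  {subset labels w <= labels (outer_h m ++ outer_v m)} ->
  map (omap (flip s)) w = w /\ erase s w = w.
Proof.
move=> m0 as_ sub.
have nw c : c \in labels w -> c \notin s by move/sub; apply: outer_avoid.
elim: w {sub} nw => // -[p|] w IH nw.
  have np : label p \notin s by apply: nw; rewrite mem_head.
  have [|e1 e2] := IH; first by move=> c cw; apply: nw; rewrite in_cons cw orbT.
  split; first by rewrite /= e1 /flip (negPf np).
  by rewrite /erase /= (negPf np) -/(erase s w) /= e2.
have [|e1 e2] := IH; first by move=> c cw; apply: nw.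
by split; rewrite /= ?e1 // /erase /= -/(erase s w) e2.
Qed.

Lemma transforms_D m : 0 < m -> transforms m (D m) [:: bar].
Proof.
elim: m => // -[_ _|m /(_ isT) IH _].
  (* [w1] is [D 1] read from a_2, which has label 4; label 1 is its virtual crossing, and 0 and 3
     will be created by the arc shift. *)
  pose w1 := [:: un 4 false; vi 1 true; un 2 false; bar; ov 4 true; vi 1 false; ov 2 true;
                 bar; bar].
  pose w2 := [:: vi 0 false; vi 3 true; vi 1 false; un 4 true; un 2 false; vi 0 true; bar;
                 ov 4 false; vi 1 true; vi 3 false; ov 2 true; bar; bar].
  pose w3 := [:: un 4 true; un 2 false; vi 0 true; bar; ov 4 false; ov 2 true; bar; bar;
                 vi 0 false].
  pose w4 := [:: bar; bar; vi 0 false; vi 0 true; bar].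
  pose w5 := [:: vi 0 false; vi 0 true; bar].
  have [d1 d2 d3 d4 d5] : [/\ diagram w1, diagram w2, diagram w3, diagram w4 & diagram w5].
    by split; apply: diagram_checkP; vm_compute.
  have d6 : diagram [:: bar] by [].
  apply: (@transformsS _ _ w1 w2).
  - exact: (equivalent_rot 3 (diagram_D (isT : 0 < 1))).
  (* The connection [x1] crosses the strand that meets the segment, once before it at 0 and once
     after it at 3, while [x2] crosses nothing. Thus 3 and 1 bound a virtual bigon, and once it is
     removed 4 and 2 bound a classical one. *)
  - exists [:: un 4 false; vi 1 true], (drop 2 w1), [:: vi 0 false; vi 3 true],
      [:: vi 1 false; un 4 true], [::], (drop 4 w2), 4, 1; split=> //.
  apply: transforms0.
  apply: (equivalent_trans (w2 := w3)).
    apply: (@equivalent_move 1 0 _ _ _ _ d2 d3) => //.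
    apply: (@VR2 (Passage 3 Virtual true, Passage 1 Virtual false)
       (Passage 1 Virtual true, Passage 3 Virtual false)
       [:: un 4 true; un 2 false; vi 0 true; bar; ov 4 false]
       [:: ov 2 true; bar; bar; vi 0 false]) => //.
    bigon_tac.
  apply: (equivalent_trans (w2 := w4)).
    apply: (@equivalent_move 4 0 _ _ _ _ d3 d4) => //.
    apply: (@RII (Passage 4 Over false, Passage 2 Over true)
      (Passage 4 Under true, Passage 2 Under false)
      [:: bar; bar; vi 0 false] [:: vi 0 true; bar]) => //.
    bigon_tac.
  (* In [D 1] the two bars on the horizontal strand are adjacent; they cancel, and the third bar
     survives to the end. *)
  apply: (equivalent_trans (w2 := w5)).
    by apply: (@equivalent_move 0 0 _ _ _ _ d4 d5) => //; apply: TII.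
  apply: (@equivalent_move 0 0 _ _ _ _ d5 d6) => //.
  exact: (@VR1 (Passage 0 Virtual false) (Passage 0 Virtual true)).
have m0 : 0 < m.+1 by [].
set X := outer_h m.+1; set Y := outer_v m.+1.
pose word4 (a b : word) := a ++ X ++ b ++ Y.
pose w0 := word4 [:: ov 4 true; bar; un 6 false; vi 5 true; un 8 false; vi 7 true]
  [:: un 4 false; bar; ov 6 true; vi 5 false; ov 8 true; vi 7 false].
(* The arc shift on 6 and 5 creates 0 and 1, placed as 0 and 3 were for [D 1]. The bigons with
   corners 1 and 5, then 6 and 8, then 0 and 7 are removed in turn. *)
pose w2 := word4
  [:: ov 4 true; bar; vi 0 false; vi 1 true; vi 5 false; un 6 true; un 8 false; vi 7 true]
  [:: un 4 false; bar; vi 0 true; ov 6 false; vi 5 true; vi 1 false; ov 8 true; vi 7 false].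
pose w3 := word4 [:: ov 4 true; bar; vi 0 false; un 6 true; un 8 false; vi 7 true]
  [:: un 4 false; bar; vi 0 true; ov 6 false; ov 8 true; vi 7 false].
pose w4 := word4 [:: ov 4 true; bar; vi 0 false; vi 7 true]
  [:: un 4 false; bar; vi 0 true; vi 7 false].
pose w5 := word4 [:: ov 4 true; bar] [:: un 4 false; bar].
have dm := diagram_D m0.
have iso5 : isotopic (D m.+1) w5.
  by exists 0, spread; split; [move=> c c' _ _ /spread_inj|rewrite rot0 relabel_D].
have d5 : diagram w5 := diagram_isotopic iso5 dm.
(* Every stage differs from [w5] only in the tangle around a_1, so planarity is inherited backwards
   from [D m.+1]. *)
have [d2 d3 d4] : [/\ diagram w2, diagram w3 & diagram w4].
  by split; apply: diagram_inner d5 => //; vm_compute.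
have d0 := diagram_D (isT : 0 < m.+2).
have iso0 : isotopic (D m.+2) w0.
  exists 0, (addn 2); split; last by rewrite rot0 relabel_D_succ.
  by move=> c c' _ _; lia.
have d1 : diagram w0 := diagram_isotopic iso0 d0.
have [subX subY] : {subset labels X <= labels (X ++ Y)} /\ {subset labels Y <= labels (X ++ Y)}.
  by rewrite labels_cat; split=> c cX; rewrite mem_cat cX ?orbT.
apply: (@transformsS _ _ (rot 2 w0) (rot 2 w2)).
- apply: equivalent_trans (equivalent_isotopic d0 iso0) _; exact: equivalent_rot.
- have [fX eX] := relabel_flip_outer (s := [:: 6; 5]) m0 isT subX.
  have [fY eY] := relabel_flip_outer (s := [:: 6; 5]) m0 isT subY.
  have [_ eX2] := relabel_flip_outer (s := [:: 0; 1]) m0 isT subX.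
  have [_ eY2] := relabel_flip_outer (s := [:: 0; 1]) m0 isT subY.
  have nXY c : c \in labels (X ++ Y) -> c \notin [:: 0; 1] by apply: outer_avoid.
  exists [:: un 6 false; vi 5 true], ([:: un 8 false; vi 7 true] ++ X ++
    [:: un 4 false; bar; ov 6 true; vi 5 false; ov 8 true; vi 7 false]
      ++ Y ++ [:: ov 4 true; bar]),
    [:: vi 0 false; vi 1 true], [:: vi 5 false; un 6 true], [::],
    ([:: un 8 false; vi 7 true] ++ X ++
    [:: un 4 false; bar; vi 0 true; ov 6 false; vi 5 true; vi 1 false; ov 8 true; vi 7 false]
      ++ Y ++ [:: ov 4 true; bar]), 6, 5; split.
  + split=> //; first exact: diagram_rot.
    by rewrite /rot /= ?drop0 -!catA.
  + split; first exact: diagram_rot.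
    by rewrite /rot /= ?drop0 -!catA.
  + have nX c : c \in [:: 0; 1] -> (c \in labels X = false) * (c \in labels Y = false).
      by move=> c01; split; apply/negP; [move/subX|move/subY] => /nXY; rewrite c01.
    split=> //.
      rewrite -all_predC; apply/allP => c c01; rewrite /= !inE in c01.
      rewrite /= (perm_mem (labels_rot _ _)) !labels_cat !mem_cat !nX ?inE //.
      by case/orP: c01 => /eqP->.
    have virt w : {subset labels w <= labels (X ++ Y)} ->
        all (fun p => (label p \in [:: 0; 1]) ==> ~~ classical p) (passages w).
      move=> sub; apply/allP => p /(map_f label)/sub/nXY.
      by rewrite /labels; case: (label p \in _).
    rewrite rot_passages (perm_all _ (permEl (perm_rot _ _))) !passages_cat !all_cat /=.
    by apply/andP; split; apply: virt.
  + by [].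
  rewrite /erase !filter_cat !map_cat -!/(erase _ _) eX2 eY2 fX fY.
  by [].
apply: transforms_equivalent IH.
apply: equivalent_trans (rst_sym _ _ _ _ (equivalent_rot 2 d2)) _.
apply: equivalent_trans (rst_sym _ _ _ _ (equivalent_isotopic dm iso5)).
apply: (equivalent_trans (w2 := w3)).
  apply: (@equivalent_move 3 3 _ _ _ _ d2 d3);
   last apply: (@VR2 (Passage 1 Virtual true, Passage 5 Virtual false)
       (Passage 5 Virtual true, Passage 1 Virtual false)
       ([:: un 6 true; un 8 false; vi 7 true] ++ X ++ [:: un 4 false; bar; vi 0 true; ov 6 false])
       ([:: ov 8 true; vi 7 false] ++ Y ++ [:: ov 4 true; bar; vi 0 false])) => //.
  - by rewrite /rot /= ?drop0 /seg -!catA.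
  - by rewrite /rot /= ?drop0 -!catA.
  bigon_tac.
apply: (equivalent_trans (w2 := w4)).
  pose a3 := [:: ov 4 true; bar; vi 0 false; un 6 true; un 8 false; vi 7 true] ++ X ++
    [:: un 4 false; bar; vi 0 true].
  pose a4 := [:: ov 4 true; bar; vi 0 false; vi 7 true] ++ X ++ [:: un 4 false; bar; vi 0 true].
  apply: (@equivalent_move (size a3) (size a4) _ _ _ _ d3 d4);
    last apply: (@RII (Passage 6 Over false, Passage 8 Over true)
      (Passage 6 Under true, Passage 8 Under false)
      ([:: vi 7 false] ++ Y ++ [:: ov 4 true; bar; vi 0 false])
      ([:: vi 7 true] ++ X ++ [:: un 4 false; bar; vi 0 true])) => //.
  - have -> : w3 = a3 ++ [:: ov 6 false; ov 8 true; vi 7 false] ++ Y.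
      by rewrite /w3 /word4 /a3 -!catA.
    by rewrite rot_size_cat /a3 /seg -!catA.
  - have -> : w4 = a4 ++ [:: vi 7 false] ++ Y by rewrite /w4 /word4 /a4 -!catA.
    by rewrite rot_size_cat /a4 -!catA.
  bigon_tac.
apply: (@equivalent_move 2 2 _ _ _ _ d4 d5);
  last apply: (@VR2 (Passage 0 Virtual false, Passage 7 Virtual true)
     (Passage 0 Virtual true, Passage 7 Virtual false)
     (X ++ [:: un 4 false; bar]) (Y ++ [:: ov 4 true; bar])) => //.
- by rewrite /rot /= ?drop0 /seg -!catA.
- by rewrite /rot /w5 /word4 /= ?drop0 ?take0 -!catA.
bigon_tac.
Qed.

(** * The odd writhe *)

Import GRing.Theory.

Fixpoint alternate (b : bool) (s : seq passage) : seq (passage * bool) :=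
  if s is p :: s' then (p, b) :: alternate (~~ b) s' else [::].

Definition crossings (w : word) : seq passage :=
  [seq p <- passages w | classical p].

(** Only over-passages count, so that a crossing is counted once; the [dir] of the over-passage
    gives the sign, as in [positive]. *)
Definition index_term (X : seq (passage * bool)) (x : passage * bool) : int :=
  if (lev x.1 == Over) && ((mate x.1, x.2) \in X) then
    if dir x.1 then 1%R else (-1)%R
  else 0%R.

Definition writhe (X : seq (passage * bool)) : int := (\sum_(x <- X) index_term X x)%R.

(* A crossing is odd when its two passages get the same colour. *)
Definition odd_writhe (w : word) : int := writhe (alternate false (crossings w)).

Lemma alternate_cat b s t :
  alternate b (s ++ t) = alternate b s ++ alternate (b (+) odd (size s)) t.
Proof.
elim: s b => [|p s IH] b /=; first by rewrite addbF.
by rewrite IH; case: b (odd _) => [] [].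
Qed.

Lemma map_fst_alternate b s : map fst (alternate b s) = s.
Proof. by elim: s b => //= p s IH b; rewrite IH. Qed.

Lemma alternate_map g b s :
  alternate b (map g s) = [seq (g x.1, x.2) | x <- alternate b s].
Proof. by elim: s b => //= p s IH b; rewrite IH. Qed.

Lemma alternate_neg b s :
  alternate (~~ b) s = [seq (x.1, ~~ x.2) | x <- alternate b s].
Proof. by elim: s b => //= p s IH b; rewrite IH. Qed.

Lemma writhe_perm X Y : perm_eq X Y -> writhe X = writhe Y.
Proof.
move=> XY; rewrite /writhe (perm_big _ XY); apply: eq_bigr => x _.
by rewrite /index_term (perm_mem XY).
Qed.

Lemma writhe_map h X :
  {in X, forall x, [/\ lev (h x).1 = lev x.1, dir (h x).1 = dir x.1 &
    ((mate (h x).1, (h x).2) \in map h X) = ((mate x.1, x.2) \in X)]} ->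
  writhe (map h X) = writhe X.
Proof.
move=> hX; rewrite /writhe big_map big_seq [RHS]big_seq; apply: eq_bigr => x xX.
by rewrite /index_term; case: (hX x xX) => -> -> ->.
Qed.

Lemma writhe_neg X : writhe [seq (x.1, ~~ x.2) | x <- X] = writhe X.
Proof.
apply: writhe_map => -[p b] _ /=; split=> //.
pose h (x : passage * bool) := (x.1, ~~ x.2).
have injh : injective h by move=> [? ?] [? ?] [-> /negb_inj->].
exact: (mem_map injh X (mate p, b)).
Qed.

Lemma writhe_cat X Y :
  {in map fst X & map fst Y, forall p q, label p != label q} ->
  writhe (X ++ Y) = (writhe X + writhe Y)%R.
Proof.
move=> XY; rewrite /writhe big_cat; congr (_ + _)%R.
all: rewrite big_seq [RHS]big_seq; apply: eq_bigr => x xX.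
all: rewrite /index_term mem_cat; set m := (mate _, _).
  case: (boolP (m \in Y)); last by rewrite orbF.
  by move/(map_f fst) => mY; have /eqP[] := XY _ _ (map_f fst xX) mY.
case: (boolP (m \in X)) => //.
by move/(map_f fst) => mX; have /eqP[] := XY _ _ mX (map_f fst xX).
Qed.

Lemma matched_disjoint s t : matched (s ++ t) -> {in s, forall p, mate p \in s} ->
  {in s & t, forall p q, label p != label q}.
Proof.
move=> mst cl p q ps qt; apply/eqP => lpq.
have := matched_uniq mst; rewrite cat_uniq => /and3P[_ /hasPn/(_ q qt) /= qs _].
have [pst qst] : p \in s ++ t /\ q \in s ++ t by rewrite !mem_cat ps qt orbT.
have /(matched_label mst pst qst lpq) eq_q : q != p.
  by apply: contraNneq qs => ->.
by rewrite eq_q cl in qs.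
Qed.

Lemma matched_catr s t : matched (s ++ t) -> {in s, forall p, mate p \in s} ->
  matched t.
Proof.
move=> m cl; have disj := matched_disjoint m cl; move: m; rewrite matched_cat.
  by case/andP.
move=> _ /mapP[p ps ->]; apply/mapP => -[q qt /eqP]; exact/negP/disj.
Qed.

(** Closed under [mate], the passages of [Y] form whole crossings, so no term of one part looks for
    its mate in the other. This isolates the passages touched by a move. *)
Lemma writhe_split X Y Z : perm_eq X (Y ++ Z) -> matched (map fst X) ->
  {in map fst Y, forall p, mate p \in map fst Y} ->
  writhe X = (writhe Y + writhe Z)%R.
Proof.
move=> XYZ mX cl; rewrite (writhe_perm XYZ); apply: writhe_cat.
apply: matched_disjoint cl; rewrite -map_cat -(matched_perm (perm_map fst XYZ)).
exact: mX.
Qed.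

Lemma classical_mate p : classical (mate p) = classical p.
Proof. by case: p => c []. Qed.

(** For classical [p] this is the sign of the crossing seen from either passage: [mate] negates
    [dir] and also exchanges over and under. *)
Definition sign (p : passage) : int :=
  if dir p == (lev p == Over) then 1%R else (-1)%R.

Lemma writhe_pair p b b' : classical p ->
  writhe [:: (p, b); (mate p, b')] = if b == b' then sign p else 0%R.
Proof.
move=> clp; rewrite /writhe !big_cons big_nil /index_term /sign !inE /= mateK.
rewrite !xpair_eqE !eqxx (negPf (mate_neq p)) (eq_sym p) (negPf (mate_neq p)) /= orbF.
by case: p clp b b' => c [] [] //= _ [] [] /=; rewrite ?addr0 ?add0r.
Qed.

Lemma matched_crossings w : well_formed w -> matched (crossings w).
Proof.
rewrite -[well_formed w]/(matched (passages w)) /crossings => mw.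
apply/allP => p; rewrite mem_filter => /andP[cp pw].
rewrite mem_filter classical_mate cp matched_mate // pw.
rewrite -(matched_count mw pw) !count_map count_filter !andbT.
apply/eqP; apply: eq_in_count => q qw /=.
case: eqP => //= lqp; have [->//|nqp] := eqVneq q p.
by rewrite (matched_label mw pw qw (esym lqp) nqp) classical_mate.
Qed.

(** [mate] permutes the list and negates [dir], so exactly half of the passages have [dir] true. *)
Lemma matched_even s : matched s -> ~~ odd (size s).
Proof.
move=> ms; have us := matched_uniq ms.
have prm : perm_eq (map mate s) s.
  apply: uniq_perm => //; first by rewrite map_inj_uniq //; apply: can_inj mateK.
  by move=> p; rewrite -{1}(mateK p) mem_map ?matched_mate //; apply: can_inj mateK.
rewrite -(count_predC dir s) -{1}(permP prm) count_map addnn.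
by rewrite (eq_count (a2 := predC dir)) ?addnn ?odd_double // => p.
Qed.

Lemma crossings_cat u v : crossings (u ++ v) = crossings u ++ crossings v.
Proof. by rewrite /crossings passages_cat filter_cat. Qed.

Lemma crossings_rot n w :
  crossings (rot n w) = rot (size (crossings (take n w))) (crossings w).
Proof.
rewrite -[X in _ = rot _ (crossings X)](cat_take_drop n w) crossings_cat rot_size_cat.
exact: crossings_cat.
Qed.

Lemma writhe_colour b s : writhe (alternate b s) = writhe (alternate false s).
Proof. by case: b => //; rewrite -[true]/(~~ false) alternate_neg writhe_neg. Qed.

(** Rotating by an even amount keeps all colours and by an odd amount exchanges them all; the even
    length makes the alternation close up at the base point. *)
Lemma writhe_rot n s : ~~ odd (size s) ->
  writhe (alternate false (rot n s)) = writhe (alternate false s).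
Proof.
rewrite -{1 3}(cat_take_drop n s) /rot size_cat oddD negb_add => /eqP eqo.
rewrite -[RHS](writhe_colour (odd (size (take n s)))) !alternate_cat addbb addFb -eqo.
by apply: writhe_perm; rewrite perm_catC.
Qed.

Lemma odd_writhe_rot n w : well_formed w -> odd_writhe (rot n w) = odd_writhe w.
Proof.
move=> wf; rewrite /odd_writhe crossings_rot writhe_rot //.
exact/matched_even/matched_crossings.
Qed.

Lemma mem_crossings w p : p \in crossings w -> (p \in passages w) && (label p \in labels w).
Proof. by rewrite mem_filter => /andP[_ pw]; rewrite pw map_f. Qed.

Lemma odd_writhe_relabel f w : {in labels w &, injective f} ->
  odd_writhe (map (omap (relabel f)) w) = odd_writhe w.
Proof.
move=> injf; rewrite /odd_writhe.
have -> : crossings (map (omap (relabel f)) w) = map (relabel f) (crossings w).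
  by rewrite /crossings passages_map filter_map.
have lab x : x \in alternate false (crossings w) -> label x.1 \in labels w.
  by move/(map_f fst); rewrite map_fst_alternate => /mem_crossings/andP[].
rewrite alternate_map; apply: writhe_map => -[p b] pX; split=> //=.
apply/mapP/idP => [[[q b'] qX [eql eqv eqd eqb]]|mX]; last by exists (mate p, b).
suff -> : (mate p, b) = (q, b') by [].
have eq_label := injf _ _ (lab _ pX) (lab _ qX) eql.
rewrite eqb; congr (_, _); rewrite /mate eq_label; case: (q) eqv eqd => ? ? ? /= -> ->.
by [].
Qed.

(** * Effect of the individual moves on the coloured writhe *)

Lemma matched_label_cat s t p q : matched (s ++ t) -> p \in s -> q \in t ->
  label p = label q -> q = mate p.
Proof.
move=> mst ps qt lpq; apply: (matched_label mst); rewrite ?mem_cat ?ps ?qt ?orbT //.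
apply: contraTneq qt => ->; apply: contraL ps => pt; apply/negP => ps.
have := matched_uniq mst; rewrite cat_uniq => /and3P[_ /hasPn/(_ p pt)].
by rewrite /= ps.
Qed.

(** Neighbours have different colours, so the crossing is even and contributes 0; deleting two
    adjacent passages keeps the other colours. *)
Lemma writhe_RI p q s : classical p -> matched [:: p, q & s] -> label p = label q ->
  writhe (alternate false [:: p, q & s]) = writhe (alternate false s).
Proof.
move=> cp m lpq; have eq_q : q = mate p.
  by apply: (@matched_label_cat [:: p] (q :: s)) => //; rewrite mem_head.
rewrite (@writhe_split _ [:: (p, false); (q, true)] (alternate false s)) //.
- by rewrite eq_q writhe_pair // add0r.
- by rewrite map_fst_alternate.
by move=> x; rewrite /= !inE eq_q => /orP[] /eqP->; rewrite ?mateK eqxx ?orbT.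
Qed.

(** The numerical content of RII: the equation on colours says that both crossings have the same
    parity, and opposite [dir] of the over-passages means opposite signs. *)
Lemma writhe_cancel X B p p' b b' c c' :
  perm_eq X ([:: (p, b); (mate p, b')] ++ [:: (p', c); (mate p', c')] ++ B) ->
  matched (map fst X) -> (b == b') = (c == c') -> lev p = Over -> lev p' = Over ->
  dir p = ~~ dir p' -> writhe X = writhe B.
Proof.
move=> prm m ebc lp lp' dpp'; rewrite (writhe_split prm m); last first.
  by move=> x; rewrite /= !inE => /orP[] /eqP->; rewrite ?mateK eqxx ?orbT.
have m' : matched (map fst ([:: (p', c); (mate p', c')] ++ B)).
  move: m; rewrite (matched_perm (perm_map fst prm)) [X in matched X -> _]map_cat.
  move=> m2; apply: (matched_catr m2).
  by move=> x; rewrite /= !inE => /orP[] /eqP->; rewrite ?mateK eqxx ?orbT.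
rewrite (@writhe_split _ [:: (p', c); (mate p', c')] B (perm_refl _) m'); last first.
  by move=> x; rewrite /= !inE => /orP[] /eqP->; rewrite ?mateK eqxx ?orbT.
rewrite !writhe_pair /classical ?lp ?lp' // ebc addrA.
suff -> : sign p = (- sign p')%R by case: ifP => _; rewrite ?addNr !add0r.
by rewrite /sign dpp' lp lp'; case: (dir p').
Qed.

Section Shuffles.
Variables (T : eqType) (a b c d : T) (s t : seq T).

Lemma perm_shuffle2 : perm_eq ([:: a] ++ s ++ [:: b] ++ t) ([:: a; b] ++ s ++ t).
Proof.
apply/permP => x; rewrite /= !count_cat /=.
move: (nat_of_bool (x a)) (nat_of_bool (x b)) (count x s) (count x t); lia.
Qed.

Lemma perm_shuffle4 :
  perm_eq ([:: a; b] ++ s ++ [:: c; d] ++ t) ([:: a; c] ++ [:: b; d] ++ s ++ t).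
Proof.
apply/permP => x; rewrite /= !count_cat /=.
move: (nat_of_bool (x a)) (nat_of_bool (x b)) (nat_of_bool (x c)) (nat_of_bool (x d))
  (count x s) (count x t); lia.
Qed.

Lemma perm_shuffle4' :
  perm_eq ([:: a; b] ++ s ++ [:: c; d] ++ t) ([:: a; d] ++ [:: b; c] ++ s ++ t).
Proof.
apply/permP => x; rewrite /= !count_cat /=.
move: (nat_of_bool (x a)) (nat_of_bool (x b)) (nat_of_bool (x c)) (nat_of_bool (x d))
  (count x s) (count x t); lia.
Qed.

End Shuffles.

Lemma writhe_RII p1 p2 q1 q2 u v :
  let P := (p1, p2) in let Q := (q1, q2) in
  matched ([:: p1; p2] ++ u ++ [:: q1; q2] ++ v) ->
  bigon P Q -> both Over P ->
  writhe (alternate false ([:: p1; p2] ++ u ++ [:: q1; q2] ++ v)) =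
  writhe (alternate false (u ++ v)).
Proof.
move=> P Q m [a [b [/andP[/eqP l1 /eqP d1] /andP[/eqP l2 /eqP d2]]]] /andP[/eqP o1 /eqP o2].
have mq p q : p \in [:: p1; p2] -> q \in [:: q1; q2] -> label p = label q -> q = mate p.
  move=> pp qq; apply: (@matched_label_cat [:: p1; p2] _ p q m pp).
  by rewrite !mem_cat qq orbT.
set X := alternate _ _; have mX : matched (map fst X) by rewrite map_fst_alternate.
have [p1P p2P q1Q q2Q] :
  [/\ p1 \in [:: p1; p2], p2 \in [:: p1; p2], q1 \in [:: q1; q2] & q2 \in [:: q1; q2]].
  by rewrite !inE !eqxx !orbT.
pose c := odd (size u); pose B := alternate false u ++ alternate c v.
have -> : alternate false (u ++ v) = B by rewrite alternate_cat.
have XE : X = [:: (p1, false); (p2, true)] ++ alternate false u ++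
    [:: (q1, c); (q2, ~~ c)] ++ alternate c v.
  by rewrite /X !alternate_cat /= ?negbK ?addbF.
(* If [a] and [b] agree, the bigon pairs [p2] with [q1] and [p1] with [q2]; otherwise it pairs equal
   indices. In each case the two turning conditions give [p1] and [p2] opposite [dir]. *)
case: a b l1 d1 l2 d2 => [] [] /= l1 d1 l2 d2.
- have e1 := mq _ _ p2P q1Q l1; have e2 := mq _ _ p1P q2Q (esym l2).
  apply: (@writhe_cancel _ B p1 p2 false (~~ c) true c) mX _ o1 o2 _.
  + by rewrite XE -e1 -e2; exact: perm_shuffle4'.
  + by case: (c).
  by move: d1 d2; rewrite e2 /=; case: (dir p1) (dir p2) => [] [].
- have e1 := mq _ _ p2P q2Q l1; have e2 := mq _ _ p1P q1Q (esym l2).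
  apply: (@writhe_cancel _ B p1 p2 false c true (~~ c)) mX _ o1 o2 _.
  + by rewrite XE -e1 -e2; exact: perm_shuffle4.
  + by case: (c).
  by move: d1 d2; rewrite e2 /=; case: (dir p1) (dir p2) => [] [].
- have e1 := mq _ _ p1P q1Q l1; have e2 := mq _ _ p2P q2Q (esym l2).
  apply: (@writhe_cancel _ B p1 p2 false c true (~~ c)) mX _ o1 o2 _.
  + by rewrite XE -e1 -e2; exact: perm_shuffle4.
  + by case: (c).
  by move: d1 d2; rewrite e2 /=; case: (dir p1) (dir p2) => [] [].
have e1 := mq _ _ p1P q2Q l1; have e2 := mq _ _ p2P q1Q (esym l2).
apply: (@writhe_cancel _ B p1 p2 false (~~ c) true c) mX _ o1 o2 _.
+ by rewrite XE -e1 -e2; exact: perm_shuffle4'.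
+ by case: (c).
by move: d1 d2; rewrite e2 /=; case: (dir p1) (dir p2) => [] [].
Qed.

Lemma writhe_swap p b b' : classical p ->
  writhe [:: (mate p, b); (p, b')] = writhe [:: (p, b); (mate p, b')].
Proof.
move=> cp; rewrite -{2}(mateK p) !writhe_pair ?classical_mate //; congr (if _ then _ else _).
by case: p cp => c [] [].
Qed.

(** Among classical passages TIII only exchanges [p] and [mate p]: the two places, hence the parity,
    and the sign are kept. *)
Lemma writhe_TIII p u v : classical p ->
  matched ([:: p] ++ u ++ [:: mate p] ++ v) ->
  writhe (alternate false ([:: mate p] ++ u ++ [:: p] ++ v)) =
  writhe (alternate false ([:: p] ++ u ++ [:: mate p] ++ v)).
Proof.
move=> cp m; pose c := ~~ odd (size u).
pose B := alternate true u ++ alternate (~~ c) v.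
have split q : q \in [:: p; mate p] ->
    writhe (alternate false ([:: q] ++ u ++ [:: mate q] ++ v)) =
    (writhe [:: (q, false); (mate q, c)] + writhe B)%R.
  move=> qp; apply: writhe_split.
  - rewrite /B /c !alternate_cat /= ?addbT.
    exact: (perm_shuffle2 (q, false) (mate q, _)).
  - rewrite map_fst_alternate -(matched_perm (s := [:: p] ++ u ++ [:: mate p] ++ v)) //.
    move: qp; rewrite !inE => /orP[] /eqP-> //; rewrite mateK.
    apply: (perm_trans (perm_shuffle2 _ _ _ _)); rewrite perm_sym.
    apply: (perm_trans (perm_shuffle2 _ _ _ _)); rewrite perm_cat2r.
    exact: (permEl (perm_catC [:: mate p] [:: p])).
  by move=> x; rewrite /= !inE => /orP[] /eqP->; rewrite ?mateK eqxx ?orbT.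
rewrite -{2}(mateK p) !split ?inE ?eqxx ?orbT // mateK writhe_swap //.
Qed.

Definition seg_start (P : segment) (a : bool) := if a then P.1 else P.2.
Definition seg_end (P : segment) (a : bool) := if a then P.2 else P.1.

Lemma left_triangle_mates P Q R s :
  matched ([:: P.1; P.2] ++ [:: Q.1; Q.2] ++ [:: R.1; R.2] ++ s) -> left_triangle P Q R ->
  exists a b c, [/\ seg_start Q b = mate (seg_end P a),
    seg_start R c = mate (seg_end Q b) & seg_start P a = mate (seg_end R c)].
Proof.
move=> m [a [b [c [/andP[/eqP l1 _] /andP[/eqP l2 _] /andP[/eqP l3 _]]]]].
have in_start (S : segment) d : seg_start S d \in [:: S.1; S.2].
  by case: d; rewrite !inE eqxx ?orbT.
have in_end (S : segment) d : seg_end S d \in [:: S.1; S.2].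
  by case: d; rewrite !inE eqxx ?orbT.
exists a, b, c; split.
- apply: (matched_label_cat m (in_end P a) _ l1).
  by rewrite mem_cat in_start.
- move: m; rewrite catA => m; apply: (matched_label_cat m _ _ l2).
    by rewrite mem_cat in_end orbT.
  by rewrite mem_cat in_start.
rewrite -[LHS]mateK; congr mate; apply/esym.
apply: (matched_label_cat m (in_start P a) _ (esym l3)).
by rewrite !mem_cat in_end orbT.
Qed.

(** The other orientation is a left triangle in the order [P], [R], [Q]; negating all three
    directions reverses that cycle. Only mates are recorded, so no turning condition has to be
    transported. *)
Lemma triangle_mates P Q R s :
  matched ([:: P.1; P.2] ++ [:: Q.1; Q.2] ++ [:: R.1; R.2] ++ s) -> triangle P Q R ->
  exists a b c, [/\ seg_start Q b = mate (seg_end P a),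
    seg_start R c = mate (seg_end Q b) & seg_start P a = mate (seg_end R c)].
Proof.
move=> m [/(left_triangle_mates m)//|tri].
have m' : matched ([:: P.1; P.2] ++ [:: R.1; R.2] ++ [:: Q.1; Q.2] ++ s).
  rewrite -(matched_perm (s := [:: P.1; P.2] ++ [:: Q.1; Q.2] ++ [:: R.1; R.2] ++ s)) //.
  by rewrite perm_cat2l perm_catCA.
have [a [b [c [e1 e2 e3]]]] := left_triangle_mates m' tri.
have flipE S d : seg_start S (~~ d) = seg_end S d by case: d.
have flipE' S d : seg_end S (~~ d) = seg_start S d by case: d.
exists (~~ a), (~~ c), (~~ b); rewrite !flipE !flipE'; split.
- by rewrite e3 mateK.
- by rewrite e2 mateK.
by rewrite e1 mateK.
Qed.

Section Shuffle6.
Variables (T : eqType) (a b c d e f : T) (s t r : seq T).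

Lemma perm_shuffle6 :
  perm_eq ([:: a; b] ++ s ++ [:: c; d] ++ t ++ [:: e; f] ++ r)
    ([:: a; b; c; d; e; f] ++ s ++ t ++ r).
Proof.
rewrite -[X in perm_eq _ X]/(([:: a; b] ++ [:: c; d] ++ [:: e; f]) ++ s ++ t ++ r).
rewrite -!catA perm_cat2l.
rewrite (perm_trans (permEl (perm_catCA s [:: c; d] _))) // perm_cat2l.
by rewrite (catA s t) perm_catCA -catA.
Qed.

Lemma perm_swap2 : perm_eq [:: a; b] [:: b; a].
Proof. exact: (permEl (perm_catC [:: a] [:: b])). Qed.

End Shuffle6.

Lemma triangle_mate_closed P Q R (a b c : bool) :
  seg_start Q b = mate (seg_end P a) -> seg_start R c = mate (seg_end Q b) ->
  seg_start P a = mate (seg_end R c) ->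
  {in [:: P.1; P.2; Q.1; Q.2; R.1; R.2], forall p,
    mate p \in [:: P.1; P.2; Q.1; Q.2; R.1; R.2]}.
Proof.
case: P Q R => [p1 p2] [q1 q2] [r1 r2]; rewrite /seg_start /seg_end /=.
move=> e1 e2 e3 x; have e1' := canRL mateK (esym e1).
have e2' := canRL mateK (esym e2); have e3' := canRL mateK (esym e3).
by rewrite !inE; case: a b c e1 e2 e3 e1' e2' e3' => [] [] [] e1 e2 e3 e1' e2' e3';
  case/or4P => [||| /or3P[]] /eqP->; rewrite -?e1 -?e2 -?e3 -?e1' -?e2' -?e3' ?eqxx ?orbT.
Qed.

(** Swapping three adjacent pairs changes the colour of all six passages. Being closed under [mate],
    they are whole crossings, whose writhe is insensitive to exchanging the two colours
    throughout. *)
Lemma writhe_RIII P Q R u v t :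
  matched ([:: P.1; P.2] ++ u ++ [:: Q.1; Q.2] ++ v ++ [:: R.1; R.2] ++ t) ->
  triangle P Q R ->
  writhe (alternate false
    ([:: P.2; P.1] ++ u ++ [:: Q.2; Q.1] ++ v ++ [:: R.2; R.1] ++ t)) =
  writhe (alternate false
    ([:: P.1; P.2] ++ u ++ [:: Q.1; Q.2] ++ v ++ [:: R.1; R.2] ++ t)).
Proof.
move=> m tri; have m6 := m; rewrite (matched_perm (perm_shuffle6 _ _ _ _ _ _ _ _ _)) in m6.
have [a [b [c [e1 e2 e3]]]] := triangle_mates m6 tri.
pose c1 := odd (size u); pose c2 := c1 (+) odd (size v).
pose A := [:: (P.1, false); (P.2, true); (Q.1, c1); (Q.2, ~~ c1); (R.1, c2); (R.2, ~~ c2)].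
pose B := alternate false u ++ alternate c1 v ++ alternate c2 t.
pose A' := [:: (P.2, false); (P.1, true); (Q.2, c1); (Q.1, ~~ c1); (R.2, c2); (R.1, ~~ c2)].
have cl := triangle_mate_closed e1 e2 e3.
rewrite [RHS](@writhe_split _ A B) ?map_fst_alternate //; last first.
  rewrite !alternate_cat /= ?addbF ?negbK; exact: perm_shuffle6.
have AA' : perm_eq A' [seq (x.1, ~~ x.2) | x <- A].
  rewrite /= !negbK; apply: (perm_cat (perm_swap2 (P.2, _) (P.1, _))).
  by apply: (perm_cat (perm_swap2 (Q.2, _) (Q.1, _))); apply: perm_swap2.
have cl' : {in map fst A', forall p, mate p \in map fst A'}.
  have AE : map fst A' =i map fst A.
    move=> p; rewrite (perm_mem (perm_map fst AA')) -map_comp.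
    by congr (_ \in _); apply: eq_map.
  by move=> p; rewrite !AE; apply: cl.
rewrite -(writhe_neg A) -(writhe_perm AA').
apply: writhe_split cl'; rewrite ?map_fst_alternate.
  rewrite !alternate_cat /= ?addbF ?negbK; exact: perm_shuffle6.
rewrite -(matched_perm (s := [:: P.1; P.2] ++ u ++ [:: Q.1; Q.2] ++ v ++ [:: R.1; R.2] ++ t)) //.
do 2!(apply: perm_cat; [apply: perm_swap2|apply: perm_cat => //]).
by apply: perm_cat; [apply: perm_swap2|].
Qed.

Lemma crossings_seg_classical P : classical P.1 -> classical P.2 ->
  crossings (seg P) = [:: P.1; P.2].
Proof. by move=> c1 c2; rewrite /crossings /seg /= c1 c2. Qed.

Lemma crossings_seg_virtual P : both Virtual P -> crossings (seg P) = [::].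
Proof. by case/andP=> /eqP c1 /eqP c2; rewrite /crossings /seg /= /classical c1 c2. Qed.

(** With at most one classical passage left, the direction in which the segment is read is
    invisible. *)
Lemma crossings_swap P a : ~~ classical (seg_end P a) ->
  crossings (seg (swap P)) = crossings (seg P).
Proof.
by case: P => p q; rewrite /crossings /seg /=; case: a => /= /negPf->; case: ifP.
Qed.

Lemma crossings_swap_start P a : ~~ classical (seg_start P a) ->
  crossings (seg (swap P)) = crossings (seg P).
Proof. by case: a; [apply: (@crossings_swap P false)|apply: (@crossings_swap P true)]. Qed.

Lemma both_classical l P a : both l P -> l != Virtual ->
  classical (seg_start P a) && classical (seg_end P a).
Proof. by case/andP=> /eqP c1 /eqP c2 nl; case: a; rewrite /classical /= c1 c2 nl. Qed.

Lemma classical_seg P a : classical (seg_start P a) -> classical (seg_end P a) ->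
  classical P.1 /\ classical P.2.
Proof. by case: a. Qed.

Lemma move_triangle P Q R u v t :
  well_formed (seg P ++ u ++ seg Q ++ v ++ seg R ++ t) -> triangle P Q R ->
  exists a b c, [/\ seg_start Q b = mate (seg_end P a),
    seg_start R c = mate (seg_end Q b) & seg_start P a = mate (seg_end R c)].
Proof.
rewrite -[well_formed _]/(matched (passages _)) !passages_cat => m.
apply: (@triangle_mates _ _ _ (passages u ++ passages v ++ passages t)).
by move: m; rewrite (matched_perm (perm_shuffle6 _ _ _ _ _ _ _ _ _)).
Qed.

Lemma move_odd_writhe w w' : well_formed w -> move w w' -> odd_writhe w' = odd_writhe w.
Proof.
move=> wf mv; case: mv wf => {w w'}.
- move=> p q u lpq cp wf; have cq : classical q.
    suff -> : q = mate p by rewrite classical_mate.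
    by apply: (@matched_label_cat [:: p] (q :: passages u)) lpq; rewrite ?mem_head.
  have := matched_crossings wf; rewrite /odd_writhe crossings_cat crossings_seg_classical //.
  by move=> m; rewrite writhe_RI.
- move=> P Q u v bg oP uQ wf; have /andP[p1 p2] := both_classical true oP isT.
  have /andP[q1 q2] := both_classical true uQ isT.
  have := matched_crossings wf; rewrite /odd_writhe !crossings_cat !crossings_seg_classical //.
  by case: P Q bg oP {uQ wf p1 p2 q1 q2} => ? ? [? ?] bg oP m; rewrite writhe_RII.
- move=> P Q R u v t tri oP uQR wf; have [a [b [c [e1 e2 e3]]]] := move_triangle wf tri.
  have /andP[p1 p2] := both_classical a oP isT.
  have q1 : classical (seg_start Q b) by rewrite e1 classical_mate.
  have r2 : classical (seg_end R c) by rewrite -classical_mate -e3.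
  (* The two corners on [P] are classical by [oP]; the corner between [Q] and [R] is classical
     because one of these segments runs under at both ends. *)
  have [q2 r1] : classical (seg_end Q b) /\ classical (seg_start R c).
    rewrite e2 classical_mate; suff : classical (seg_end Q b) by [].
    case/orP: uQR => [/both_classical|/both_classical].
      by move=> /(_ b isT)/andP[].
    by move=> /(_ c isT)/andP[]; rewrite e2 classical_mate.
  have [P1 P2] := classical_seg p1 p2; have [Q1 Q2] := classical_seg q1 q2.
  have [R1 R2] := classical_seg r1 r2.
  have := matched_crossings wf; rewrite /odd_writhe !crossings_cat !crossings_seg_classical //.
  by move=> m; apply: (writhe_RIII m tri).
- move=> p q u lpq cp wf; have cq : ~~ classical q.
    suff -> : q = mate p by rewrite classical_mate.
    by apply: (@matched_label_cat [:: p] (q :: passages u)) lpq; rewrite ?mem_head.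
  rewrite /odd_writhe crossings_cat.
  by rewrite /crossings /= (negPf cp) (negPf cq).
- move=> P Q u v _ vP vQ _; rewrite /odd_writhe !crossings_cat.
  by rewrite !crossings_seg_virtual.
- move=> P Q R u v t _ vP vQ vR _; rewrite /odd_writhe !crossings_cat.
  by rewrite !crossings_seg_virtual // /both andbC.
- move=> P Q R u v t tri vP _ wf; have [a [b [c [e1 e2 e3]]]] := move_triangle wf tri.
  (* Both corners on [P] are virtual, so [Q] and [R] each have a virtual end and their reversals do
     not alter the classical word. *)
  have [p1 p2] : ~~ classical (seg_start P a) /\ ~~ classical (seg_end P a).
    by case/andP: vP => /eqP v1 /eqP v2; case: (a); rewrite /classical /= v1 v2.
  rewrite /odd_writhe !crossings_cat (crossings_swap p2) (@crossings_swap_start Q b) //.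
    by rewrite (@crossings_swap R c) // -classical_mate -e3.
  by rewrite e1 classical_mate.
- by [].
- by [].
- move=> c d x y u v wf; have := matched_crossings wf.
  rewrite /odd_writhe !crossings_cat /=.
  exact: (@writhe_TIII (Passage c Over d)).
move=> c d x y u v wf; have := matched_crossings wf.
rewrite /odd_writhe !crossings_cat /=.
exact: (@writhe_TIII (Passage c Over d)).
Qed.

Lemma odd_writhe_isotopic w w' : well_formed w -> isotopic w w' ->
  odd_writhe w' = odd_writhe w.
Proof.
move=> wf [i [f [injf ->]]]; rewrite odd_writhe_relabel ?odd_writhe_rot //.
by move=> c c'; rewrite !(perm_mem (labels_rot i w)); apply: injf.
Qed.

Lemma odd_writhe_equivalent w w' : equivalent w w' -> odd_writhe w = odd_writhe w'.
Proof.
elim=> // [w1 w2 [/andP[wf _] _ [iso|mv]]|w1 w2 w3 _ -> _ -> //].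
  by rewrite (odd_writhe_isotopic wf iso).
by rewrite (move_odd_writhe wf mv).
Qed.

Lemma sign_flip C p : label p \in C -> classical p -> sign (flip C p) = (- sign p)%R.
Proof.
by rewrite /flip => -> cp; rewrite /sign; case: p cp => c [] [] //= _; rewrite opprK.
Qed.

Lemma flip_mate C p : flip C (mate p) = mate (flip C p).
Proof. by rewrite /flip /=; case: ifP. Qed.

Lemma classical_flip C p : classical (flip C p) = classical p.
Proof. by rewrite /flip; case: ifP. Qed.

Lemma crossings_map_flip C w :
  crossings (map (omap (flip C)) w) = map (flip C) (crossings w).
Proof.
rewrite /crossings passages_map filter_map; congr map; apply: eq_filter => p.
exact: classical_flip.
Qed.

Lemma crossings_rev w : crossings (rev w) = rev (crossings w).
Proof.
rewrite /crossings -filter_rev; congr filter.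
elim: w => // -[p|] w IH; rewrite rev_cons -cats1 passages_cat IH ?cats0 //=.
by rewrite rev_cons -cats1.
Qed.

Lemma crossings_erase N w :
  all (fun p => (label p \in N) ==> ~~ classical p) (passages w) ->
  crossings (erase N w) = crossings w.
Proof.
elim: w => // -[p|] w IH //= /andP[pN /IH]; rewrite /crossings /erase /=.
by case: ifP => [pN'|/negbFE pN'] /=; move: pN; rewrite ?pN' /= => cp; rewrite ?(negPf cp) => ->.
Qed.

Definition odd_index (p : passage) (b b' : bool) : int :=
  if b == b' then sign p else 0%R.

(** * Arc shifts and the odd writhe *)

Lemma writhe_remove_pair X Z p b b' : classical p -> matched (map fst X) ->
  perm_eq X ([:: (p, b); (mate p, b')] ++ Z) ->
  [/\ writhe X = (odd_index p b b' + writhe Z)%R, matched (map fst Z) &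
    {in Z, forall x, label x.1 != label p}].
Proof.
move=> cp mX prm.
have cl : {in [:: p; mate p], forall q, mate q \in [:: p; mate p]}.
  by move=> q; rewrite !inE => /orP[] /eqP->; rewrite ?mateK eqxx ?orbT.
have mYZ : matched ([:: p; mate p] ++ map fst Z).
  by move: mX; rewrite (matched_perm (perm_map fst prm)).
split; last 1 first.
- move=> x /(map_f fst) xZ; rewrite eq_sym.
  by apply: (matched_disjoint mYZ cl) xZ; apply: mem_head.
- by rewrite (writhe_split prm mX) // writhe_pair.
exact: matched_catr mYZ cl.
Qed.

Lemma coloured_mate p b s : mate p \in s ->
  exists y Z, perm_eq (alternate b s) ((mate p, y) :: Z).
Proof.
rewrite -{1}(map_fst_alternate b s) => /mapP[[q y] qs /= eq_q].
by exists y, (rem (mate p, y) (alternate b s)); apply: perm_to_rem; rewrite eq_q.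
Qed.

Definition flip_coloured C (x : passage * bool) := (flip C x.1, x.2).

Lemma flip_coloured_id C Z : {in Z, forall x, label x.1 \notin C} ->
  map (flip_coloured C) Z = Z.
Proof.
move=> ZC; rewrite -[RHS]map_id; apply/eq_in_map => -[p b] /ZC /= pC.
by rewrite /flip_coloured /flip /= (negPf pC).
Qed.

Lemma odd_index_bound p b b' : (-1 <= odd_index p b b' <= 1)%R.
Proof. by rewrite /odd_index /sign; case: ifP => //; case: ifP. Qed.

(** With a single classical crossing on the segment the classical order stays and one sign flips;
    the index of that crossing moves within [-1, 1]. *)
Lemma arc_shift_one C p t : classical p -> label p \in C ->
  {in t, forall q, label q \in C -> label q = label p} ->
  matched (p :: t) -> matched (flip C p :: map (flip C) t) ->
  (`|writhe (alternate false (flip C p :: map (flip C) t)) -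
     writhe (alternate false (p :: t))| <= 2)%R.
Proof.
move=> cp pC tC m m'; have mt : mate p \in t.
  have := matched_mate m p; rewrite mem_head !inE (negPf (mate_neq p)) //.
have [y [Z prm]] := coloured_mate true mt.
have [||-> _ nZ] := @writhe_remove_pair (alternate false (p :: t)) Z p false y cp.
- by rewrite map_fst_alternate.
- by rewrite /= perm_cons.
have CZ : {in Z, forall x, label x.1 \notin C}.
  move=> x xZ; apply: contra (nZ x xZ) => /tC-> //.
  have : x \in alternate true t by rewrite (perm_mem prm) in_cons xZ orbT.
  by move/(map_f fst); rewrite map_fst_alternate.
have [|||-> _ _] := @writhe_remove_pair (alternate false (flip C p :: map (flip C) t)) Z
  (flip C p) false y.
- by rewrite classical_flip.
- by rewrite map_fst_alternate.
- rewrite /= perm_cons alternate_map -(flip_coloured_id CZ).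
  by rewrite (perm_trans (perm_map (flip_coloured C) prm)) //= /flip_coloured /= flip_mate.
move: (odd_index_bound p false y) (odd_index_bound (flip C p) false y).
move: (odd_index _ _ _) (odd_index _ _ _) (writhe Z); clear => e1 e2 W; lia.
Qed.

(** Exchanging [p] and [q] exchanges their colours while the mates keep theirs, so each crossing
    changes parity and counts in only one of the two writhes. Each accounts for a change of at most
    1; sign flips without the change of parity could add up to 4. *)
Lemma arc_shift_two C p q t : classical p -> classical q -> label p != label q ->
  C = [:: label p; label q] ->
  matched [:: p, q & t] -> matched [:: flip C q, flip C p & map (flip C) t] ->
  (`|writhe (alternate false [:: flip C q, flip C p & map (flip C) t]) -
     writhe (alternate false [:: p, q & t])| <= 2)%R.
Proof.
move=> cp cq npq defC m m'.
have [mp mq] : mate p \in t /\ mate q \in t.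
  have := matched_mate m p; have := matched_mate m q.
  rewrite !inE !eqxx !orbT (negPf (mate_neq p)) (negPf (mate_neq q)) /=.
  have -> : (mate p == q) = false by apply: contraNF npq => /eqP<-.
  by have -> : (mate q == p) = false by apply: contraNF npq => /eqP<-.
have [y [Z1 prm1]] := coloured_mate false mp.
have mq1 : mate q \in map fst Z1.
  have : mate q \in map fst ((mate p, y) :: Z1).
    by rewrite -(perm_mem (perm_map fst prm1)) map_fst_alternate.
  rewrite /= in_cons => /predU1P[/(congr1 label) /= eql|//].
  by rewrite eql eqxx in npq.
have [[q' z] qZ /= eq_q] := mapP mq1; rewrite -{}eq_q in qZ.
pose Z := rem (mate q, z) Z1.
have prm : perm_eq (alternate false t) [:: (mate p, y), (mate q, z) & Z].
  by rewrite (perm_trans prm1) // perm_cons perm_to_rem.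
have [||-> m1 nZp] := @writhe_remove_pair (alternate false [:: p, q & t])
    [:: (q, true), (mate q, z) & Z] p false y cp.
- by rewrite map_fst_alternate.
- rewrite -[X in perm_eq X _]/([:: (p, false); (q, true)] ++ alternate false t).
  by rewrite (perm_trans (perm_cat (perm_refl _) prm)) // perm_cons (perm_catCA [:: _] [:: _]).
have [|-> _ nZq] := writhe_remove_pair cq m1 (Z := Z) (b := true) (b' := z).
  exact: perm_refl.
have CZ : {in Z, forall x, label x.1 \notin C}.
  move=> x xZ; rewrite defC !inE negb_or nZq // nZp //.
  by rewrite !inE xZ !orbT.
have [|||-> m1' _] := @writhe_remove_pair
    (alternate false [:: flip C q, flip C p & map (flip C) t])
    [:: (flip C q, false), (mate (flip C q), z) & Z] (flip C p) true y.
- by rewrite classical_flip.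
- by rewrite map_fst_alternate.
- rewrite -[X in perm_eq X _]/([:: (flip C q, false); (flip C p, true)] ++
    alternate false (map (flip C) t)) alternate_map.
  have prm' : perm_eq (map (flip_coloured C) (alternate false t))
      [:: (mate (flip C p), y), (mate (flip C q), z) & Z].
    rewrite -(flip_coloured_id CZ) (perm_trans (perm_map (flip_coloured C) prm)) //=.
    by rewrite /flip_coloured /= !flip_mate.
  rewrite (perm_trans (perm_cat (perm_refl _) prm')) //.
  exact: (permEl (perm_catCA [:: _] [:: _; _] _)).
have [||-> _ _] := writhe_remove_pair _ m1' (Z := Z) (p := flip C q) (b := false) (b' := z).
- by rewrite classical_flip.
- exact: perm_refl.
have sp := sign_flip (C := C) (p := p); have sq := sign_flip (C := C) (p := q).
rewrite /odd_index sp ?sq //; try by rewrite defC !inE eqxx ?orbT.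
have bs r : (-1 <= sign r <= 1)%R by rewrite /sign; case: ifP.
case: (y) (z) => [] [] /=; move: (sign p) (sign q) (writhe Z) (bs p) (bs q); clear;
  move=> /= e1 e2 W; lia.
Qed.

Lemma crossings_virtual w : {in passages w, forall p, ~~ classical p} -> crossings w = [::].
Proof.
move=> vw; rewrite /crossings (eq_in_filter (a2 := pred0)) ?filter_pred0 // => p /vw.
exact: negbTE.
Qed.

Lemma arc_shift_odd_writhe w w' : arc_shift w w' ->
  (`|odd_writhe w' - odd_writhe w| <= 2)%R.
Proof.
case=> s [t [x1 [s' [x2 [t' [c1 [c2 [[dw ew ls c12] [dw' ew'] [_ _ virt] es et]]]]]]]].
set N := labels (x1 ++ x2) in virt es et; set C := [:: c1; c2] in es et.
have mw : matched (passages w) by case/andP: dw.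
have mX := matched_crossings (proj1 (andP dw)).
have mX' := matched_crossings (proj1 (andP dw')).
rewrite ew' !passages_cat !all_cat in virt; have /and4P[v1 vs v2 vt] := virt.
have cx1 : crossings x1 = [::].
  apply: crossings_virtual => p px; apply: (implyP (allP v1 p px)).
  by rewrite /N labels_cat mem_cat; apply/orP; left; apply: map_f.
have cx2 : crossings x2 = [::].
  apply: crossings_virtual => p px; apply: (implyP (allP v2 p px)).
  by rewrite /N labels_cat mem_cat; apply/orP; right; apply: map_f.
have cw' : crossings w' = rev (map (flip C) (crossings s)) ++ map (flip C) (crossings t).
  rewrite ew' !crossings_cat cx1 cx2 /= -(crossings_erase vs) es crossings_rev.
  by rewrite crossings_map_flip -(crossings_erase vt) et crossings_map_flip.
have cw : crossings w = crossings s ++ crossings t by rewrite ew crossings_cat.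
rewrite /odd_writhe cw cw'; rewrite cw in mX; rewrite cw' in mX'.
have [p1 [p2 [def_s l1 l2]]] : exists p1 p2, [/\ passages s = [:: p1; p2],
    label p1 = c1 & label p2 = c2].
  by move: ls; rewrite /labels; case: (passages s) => [|p1 [|p2 []]] //= [<- <-]; exists p1, p2.
(* Needed so that the flip at a virtual crossing of the segment leaves every classical passage
   alone. *)
have virtual_label p q : p \in passages w -> ~~ classical p -> q \in crossings t ->
    label q != label p.
  move=> pw np qt; apply/eqP => lqp.
  have : q \in crossings w by rewrite cw mem_cat qt orbT.
  rewrite mem_filter => /andP[cq qw]; case: (eqVneq q p) => [eq_qp|nqp].
    by rewrite eq_qp (negPf np) in cq.
  by rewrite (matched_label mw pw qw (esym lqp) nqp) classical_mate (negPf np) in cq.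
have [p1w p2w] : p1 \in passages w /\ p2 \in passages w.
  by rewrite ew passages_cat !mem_cat def_s !inE !eqxx orbT.
have cs : crossings s = [seq p <- [:: p1; p2] | classical p] by rewrite /crossings def_s.
have rev1 p : rev [:: flip C p] = [:: flip C p] by [].
have rev2 : rev [:: flip C p1; flip C p2] = [:: flip C p2; flip C p1] by [].
move: mX mX'; rewrite cs /=.
case: (boolP (classical p1)) (boolP (classical p2)) => [k1|n1] [k2|n2];
  rewrite /= ?rev2 ?rev1 => mX mX'.
- by apply: arc_shift_two => //; rewrite ?l1 ?l2.
- apply: arc_shift_one => //; first by rewrite l1 mem_head.
  move=> q qt; rewrite mem_seq2 => /orP[/eqP->//|/eqP lq].
  by have /eqP[] := virtual_label _ _ p2w n2 qt; rewrite lq l2.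
- apply: arc_shift_one => //; first by rewrite l2 mem_seq2 eqxx orbT.
  move=> q qt; rewrite mem_seq2 => /orP[/eqP lq|/eqP->//].
  by have /eqP[] := virtual_label _ _ p1w n1 qt; rewrite lq l1.
rewrite map_id_in ?subrr ?normr0 // => q qt; rewrite /flip !inE -l1 -l2.
by rewrite (negPf (virtual_label _ _ p1w n1 qt)) (negPf (virtual_label _ _ p2w n2 qt)).
Qed.

(** * The lower bound and the arc shift number *)

Lemma transforms_odd_writhe k w w' : transforms k w w' ->
  (`|odd_writhe w' - odd_writhe w| <= k.*2%:R)%R.
Proof.
elim=> {k w w'} [w w' /odd_writhe_equivalent->|k w w1 w2 w' /odd_writhe_equivalent-> sh _ IH].
  by rewrite subrr.
have := arc_shift_odd_writhe sh; move: IH; rewrite !natz; lia.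
Qed.

Lemma writhe_alternate_mates b s :
  {in s, forall p, lev p = Over /\ dir p} ->
  writhe (alternate b s ++ alternate b (map mate s)) = ((size s)%:R)%R.
Proof.
move=> sO; rewrite /writhe big_cat /= [X in (_ + X)%R]big_seq [X in (_ + X)%R]big1.
  rewrite addr0 big_seq (eq_bigr (fun=> 1%R)); last first.
    move=> [p c] ps; rewrite /index_term mem_cat alternate_map.
    have : p \in s by rewrite -(map_fst_alternate b s) (map_f fst ps).
    case/sO => /= -> ->; have -> // : (mate p, c) \in [seq (mate x.1, x.2) | x <- alternate b s].
      by apply/mapP; exists (p, c).
    by rewrite orbT.
  rewrite -big_seq big_const_seq count_predT -(size_map fst) map_fst_alternate.
  by rewrite iter_addr_0.
rewrite alternate_map => x /mapP[[p c] ps ->]; rewrite /index_term /=.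
have : p \in s by rewrite -(map_fst_alternate b s) (map_f fst ps).
by case/sO => ->.
Qed.

Lemma crossings_not_virtual w :
  crossings w = passages [seq x <- w | not_virtual x].
Proof.
elim: w => // -[p|] w IH //=; rewrite /crossings /=.
by case: ifP => cp /=; rewrite -[filter _ _]/(crossings w) IH.
Qed.

(** With [S] the over-passages of a_2 up to a_2n, the classical word is a_1, the mates of [S], the
    mate of a_1, [S]. As [S] has odd length 2n - 1, each passage is 2n places from its mate, so all
    crossings are odd. *)
Lemma odd_writhe_D n : 0 < n -> odd_writhe (D n) = ((n.*2)%:R)%R.
Proof.
move=> n0; rewrite /odd_writhe crossings_not_virtual D_gauss //.
set S := [seq Passage (la k) Over true | k <- iota 2 (n.*2).-1].
have pm l d s : passages [seq pass (la k) l d | k <- s] = [seq Passage (la k) l d | k <- s].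
  by elim: s => //= k s ->.
have -> : passages ([:: pass (la 1) Over true; bar] ++
    [seq pass (la k) Under false | k <- iota 2 (n.*2 - 2)] ++
    [:: bar; pass (la n.*2) Under false; pass (la 1) Under false; bar] ++
    [seq pass (la k) Over true | k <- iota 2 (n.*2).-1]) =
  [:: Passage (la 1) Over true] ++ map mate S ++ [:: mate (Passage (la 1) Over true)] ++ S.
  rewrite !passages_cat /= !pm -/S -map_comp /=.
  have -> : (n.*2).-1 = n.*2 - 2 + 1 by lia.
  by rewrite iotaD map_cat -catA /=; congr (_ :: _ ++ [:: Passage (la _) _ _, _ & _]); lia.
have <- : size (Passage (la 1) Over true :: S) = n.*2.
  by rewrite /= size_map size_iota; lia.
rewrite -(@writhe_alternate_mates false); last first.
  by move=> p; rewrite inE => /predU1P[->//|/mapP[k _ ->]].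
have oS : odd (size S).
  by rewrite size_map size_iota; case: (n) n0 => // k _; rewrite doubleS /= odd_double.
apply: writhe_perm; rewrite !alternate_cat /= size_map oS /=.
by rewrite perm_cons perm_catC (permEl (perm_catCA [:: _] _ _)).
Qed.

Theorem proposition3p17 (n : nat) (hn : 1 < n) :
  arc_shift_number (twisted_knot (D n)) n.
Proof.
have n0 : 0 < n by apply: ltnW.
(* The writhe must go from 2n to 0 in steps of at most 2. Stated for every representative [w], the
   bound serves both minima: over chains from [D n] and over all diagrams of the knot. *)
have lower w u k : twisted_knot (D n) w -> trivial_diagram u -> transforms k w u -> n <= k.
  case=> _ /odd_writhe_equivalent eqw u0 /transforms_odd_writhe.
  have -> : odd_writhe u = 0%R.
    by case: u0 => ->; rewrite /odd_writhe /writhe /= big_nil.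
  rewrite -eqw odd_writhe_D // !natz; lia.
split.
  exists (D n); first by split; [apply: diagram_D|apply: rst_refl].
  split; first by exists [:: bar]; [right|apply: transforms_D].
  move=> j [u u0 tr]; apply: (lower (D n) u) => //.
  by split; [apply: diagram_D|apply: rst_refl].
by move=> j [w kw [[u u0 tr] _]]; apply: lower tr.
Qed.
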